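(* Let $d\ge3$ and let $V$ be a real vector space of dimension $n\ge2$. Let $k\ge2$. Then $$\pi_k\bigl(\{A\in\mathsf{S}^d(V):\operatorname{rank}_{\mathsf{S}}(A)=1\}\bigr)\cong\pi_k(\mathbb{S}^{n-1}).$$ In particular, if $n\ge4$ and $2\le k\le n-2$, then $$\pi_k\bigl(\{A\in\mathsf{S}^d(V):\operatorname{rank}_{\mathsf{S}}(A)=1\}\bigr)=0.$$
   Context: All sets carry the Euclidean topology. $\mathsf{S}^d(V)\subseteq V^{\otimes d}$ is the space of symmetric $d$-tensors. $\operatorname{rank}_{\mathsf{S}}(A)=1$ means $A=\lambda v^{\otimes d}$ for some nonzero $\lambda\in\mathbb{R}$ and nonzero $v\in V$ (a nonzero point of the affine cone over the real Veronese variety). When $d$ is even this set is disconnected; the statement is for any choice of base point. $\mathbb{S}^{n-1}$ is the $(n-1)$-sphere. *)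

(* Defs.v *)
From HB Require Import structures.
From mathcomp Require Import all_boot all_order all_fingroup all_algebra.
From mathcomp Require Import generic_quotient lra.
From mathcomp Require Import all_classical all_reals all_analysis.

Set Implicit Arguments.
Unset Strict Implicit.
Unset Printing Implicit Defensive.

Import Order.TTheory GRing.Theory Num.Theory.
Import numFieldNormedType.Exports.

Local Open Scope classical_set_scope.
Local Open Scope ring_scope.
Local Open Scope quotient_scope.

Lemma within_continuous_compr {S T U : topologicalType} (A : set T) (B : set S)
    (f : T -> U) (g : S -> T) :
  continuous g -> (forall y, B y -> A (g y)) ->
  {within A, continuous f} -> {within B, continuous (f \o g)}.
Proof.
move=> cg gBA /subspace_continuousP cf; apply/subspace_continuousP => y By.
apply: (cvg_trans _ (cf _ (gBA _ By))) => P /= fP.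
have /cg := fP; rewrite /nbhs /= /within /=.
by apply: filterS => z hz Bz; apply: hz => //; exact: gBA.
Qed.

Lemma within_continuous_eq {T U : topologicalType} (A : set T) (f g : T -> U) :
  (forall t, A t -> f t = g t) ->
  {within A, continuous f} -> {within A, continuous g}.
Proof.
move=> fg; apply: subspace_eq_continuous => t /set_mem At; exact: fg.
Qed.

Lemma within_continuous_glue {R : realType} {T U : topologicalType}
    (A : set T) (c : T -> R) (f g : T -> U) (a : R) :
  closed A -> continuous c -> (forall t, A t -> c t = a -> f t = g t) ->
  {within A `&` [set t | c t <= a], continuous f} ->
  {within A `&` [set t | a <= c t], continuous g} ->
  {within A, continuous (fun t => if c t <= a then f t else g t)}.
Proof.
move=> cA cc fg cf cg.
have -> : A = (A `&` [set t | c t <= a]) `|` (A `&` [set t | a <= c t]).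
  rewrite -setIUr; apply/seteqP; split => [t At|t []//]; split => //=.
  by apply/orP; exact: le_total.
have cl1 : closed (A `&` [set t | c t <= a]).
  apply: closedI => //; apply: (@preimage_closed _ _ c [set x | x <= a]).
    by move=> ? _; exact: cc.
  exact: closed_le.
have cl2 : closed (A `&` [set t | a <= c t]).
  apply: closedI => //; apply: (@preimage_closed _ _ c [set x | a <= x]).
    by move=> ? _; exact: cc.
  exact: closed_ge.
apply: withinU_continuous => //.
  by apply: within_continuous_eq cf => t [_ /= ->].
apply: within_continuous_eq cg => t [At /= ct]; case: ifPn => // ct'.
by rewrite fg//; apply/eqP; rewrite eq_le ct'.
Qed.

Lemma continuous_pair {S T U : topologicalType} (f : S -> T) (g : S -> U) :
  continuous f -> continuous g -> continuous (fun s => (f s, g s)).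
Proof. by move=> cf cg s; apply: cvg_pair; [exact: cf|exact: cg]. Qed.

Lemma continuous_row {R : realType} {S : topologicalType} m
    (f : S -> 'rV[R]_m) :
  (forall i, continuous (fun s => f s ord0 i)) -> continuous f.
Proof.
move=> cf s A [P fP sPA].
have : \forall y \near s, forall i, P ord0 i (f y ord0 i).
  by apply: filter_forall => i; apply: cf; exact: fP.
by apply: filterS => y Py; apply: sPA => i j; rewrite (ord1 i); exact: Py.
Qed.

(** Homotopy groups.  The cubes [0,1]^m.+1 are subsets of 'rV[R]_m.+1; a map of
    pairs (I^m.+1, bd I^m.+1) -> (X, x0) is encoded by a total function whose
    values outside the cube are irrelevant. *)
Section cube.
Context {R : realType} {m : nat}.
Implicit Types t : 'rV[R]_m.+1.

Definition cube : set 'rV[R]_m.+1 :=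
  [set t | forall i, 0 <= t ord0 i <= 1].

Definition cube_boundary : set 'rV[R]_m.+1 :=
  [set t | cube t /\ exists i, t ord0 i = 0 \/ t ord0 i = 1].

Definition set_first t (a : R) : 'rV[R]_m.+1 :=
  \row_i (if i == ord0 then a else t ord0 i).

Lemma set_first0 t a : set_first t a ord0 ord0 = a.
Proof. by rewrite mxE eqxx. Qed.

Lemma set_first_id t : set_first t (t ord0 ord0) = t.
Proof. by apply/rowP => i; rewrite mxE; case: eqP => // ->. Qed.

Lemma set_first_twice t a b : set_first (set_first t a) b = set_first t b.
Proof. by apply/rowP => i; rewrite !mxE; case: eqP. Qed.

Lemma cube_set_first t a : cube t -> 0 <= a <= 1 -> cube (set_first t a).
Proof. by move=> It Ia i; rewrite mxE; case: ifP. Qed.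

Lemma boundary_set_first t a : cube t -> a = 0 \/ a = 1 ->
  cube_boundary (set_first t a).
Proof.
move=> It Ia; split; last by exists ord0; rewrite set_first0.
by apply: cube_set_first => //; case: Ia => ->; rewrite lexx ler01.
Qed.

Lemma boundary_set_first_neq t a : cube_boundary t -> 0 <= a <= 1 ->
  t ord0 ord0 <> 0 -> t ord0 ord0 <> 1 -> cube_boundary (set_first t a).
Proof.
move=> [It [i ti]] Ia t0 t1; split; first exact: cube_set_first.
by exists i; rewrite mxE; case: eqP => // i0; case: ti; rewrite i0.
Qed.

Lemma continuous_set_first {S : topologicalType} (f : S -> 'rV[R]_m.+1)
    (a : S -> R) : continuous f -> continuous a ->
  continuous (fun s => set_first (f s) (a s)).
Proof.
move=> cf ca; apply: continuous_row => i.
have [i0|i0] := eqVneq i ord0.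
  rewrite (_ : (fun _ => _) = a)//.
  by apply/funext => s; rewrite mxE i0 eqxx.
rewrite (_ : (fun _ => _) = (fun s => f s ord0 i)); last first.
  by apply/funext => s; rewrite mxE (negbTE i0).
move=> s; apply: (@continuous_comp _ _ _ f (fun t => t ord0 i)); first exact: cf.
exact: coord_continuous.
Qed.

Lemma closed_cube : closed cube.
Proof.
have -> : cube = \bigcap_(i in [set: 'I_m.+1])
   ((fun t => t ord0 i) @^-1` [set x | 0 <= x <= 1]).
  by apply/seteqP; split => [t It i _|t It i]; [exact: It|exact: (It i)].
apply: closed_bigI => i _.
apply: preimage_closed => [? _|]; first exact: coord_continuous.
rewrite (_ : [set x | _] = [set x : R | 0 <= x] `&` [set x : R | x <= 1]).
  by apply: closedI; [exact: closed_ge|exact: closed_le].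
by apply/seteqP; split => x /= => [/andP[]|[-> ->]].
Qed.

End cube.

Section homotopy_group.
Context {R : realType} {m : nat} {X : topologicalType} (x0 : X).
Implicit Types t : 'rV[R]_m.+1.

Local Notation I := [set x : R | 0 <= x <= 1].
Local Notation cube := (@cube R m).
Local Notation cube_boundary := (@cube_boundary R m).

Record loop := Loop {
  loop_fun :> 'rV[R]_m.+1 -> X ;
  loop_cont : {within cube, continuous loop_fun} ;
  loop_base : forall t, cube_boundary t -> loop_fun t = x0 }.

HB.instance Definition _ := gen_eqMixin loop.
HB.instance Definition _ := gen_choiceMixin loop.

Definition homotopic (f g : loop) : Prop :=
  exists H : R * 'rV[R]_m.+1 -> X,
    [/\ {within I `*` cube, continuous H},
        forall t, cube t -> H (0, t) = f t,
        forall t, cube t -> H (1, t) = g t &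
        forall s t, I s -> cube_boundary t -> H (s, t) = x0].

Lemma cubeI t : cube t -> 0 <= t ord0 ord0 <= 1. Proof. exact. Qed.

Lemma continuous_first : continuous (fun t => t ord0 ord0).
Proof. exact: coord_continuous. Qed.

Lemma continuous_comp_first {S : topologicalType} (u : S -> 'rV[R]_m.+1) :
  continuous u -> continuous (fun s => u s ord0 ord0).
Proof.
move=> cu s; apply: (@continuous_comp _ _ _ u (fun t => t ord0 ord0)).
  exact: cu.
exact: continuous_first.
Qed.

Lemma homotopic_eq (f g : loop) :
  (forall t, cube t -> f t = g t) -> homotopic f g.
Proof.
move=> fg; exists (f \o snd); split => //=.
- apply: (@within_continuous_compr _ _ _ cube _ f); last exact: loop_cont.
    by move=> ?; exact: cvg_snd.
  by move=> [s t] [].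
- by move=> s t _; exact: loop_base.
Qed.

Lemma homotopic_refl f : homotopic f f.
Proof. exact: homotopic_eq. Qed.

Lemma homotopic_sym f g : homotopic f g -> homotopic g f.
Proof.
move=> [H [cH H0 H1 Hb]]; exists (H \o (fun p => (1 - p.1, p.2))); split => /=.
- apply: within_continuous_compr cH.
    apply: continuous_pair => p; last exact: cvg_snd.
    by apply: cvgB; [exact: cvg_cst|exact: cvg_fst].
  by move=> [s t] /= [? ?]; split => //=; lra.
- by move=> t It; rewrite subr0 H1.
- by move=> t It; rewrite subrr H0.
- by move=> s t Is; apply: Hb => /=; move: Is => /=; lra.
Qed.

Lemma closed_I : closed I.
Proof.
rewrite (_ : I = [set x : R | 0 <= x] `&` [set x : R | x <= 1]).
  by apply: closedI; [exact: closed_ge|exact: closed_le].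
by apply/seteqP; split => x /= => [/andP[]|[-> ->]].
Qed.

Lemma closed_Icube : closed (I `*` cube).
Proof.
have -> : I `*` cube = (fst @^-1` I) `&` (snd @^-1` cube) by [].
apply: closedI; apply: preimage_closed.
- by move=> ? _; exact: cvg_fst.
- exact: closed_I.
- by move=> ? _; exact: cvg_snd.
- exact: closed_cube.
Qed.

Lemma homotopic_trans f g h : homotopic f g -> homotopic g h -> homotopic f h.
Proof.
move=> [H [cH H0 H1 Hb]] [K [cK K0 K1 Kb]].
exists (fun p => if p.1 <= 2^-1 then (H \o (fun p => (2 * p.1, p.2))) p
            else (K \o (fun p => (2 * p.1 - 1, p.2))) p); split => /=.
- apply: within_continuous_glue => //.
  + exact: closed_Icube.
  + by move=> ?; exact: cvg_fst.
  + move=> [s t] /= [Is It] ->.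
    by rewrite mulfV// subrr H1// K0.
  + apply: within_continuous_compr cH.
      apply: continuous_pair => p; last exact: cvg_snd.
      by apply: cvgM; [exact: cvg_cst|exact: cvg_fst].
    by move=> [s t] /= [[Is It]] s2; split => //=; move: Is s2 => /=; lra.
  + apply: within_continuous_compr cK.
      apply: continuous_pair => p; last exact: cvg_snd.
      apply: cvgB; last exact: cvg_cst.
      by apply: cvgM; [exact: cvg_cst|exact: cvg_fst].
    by move=> [s t] /= [[Is It]] s2; split => //=; move: Is s2 => /=; lra.
- by move=> t It; rewrite ifT ?mulr0 ?H0// invr_ge0.
- move=> t It; rewrite ifF; last by lra.
  by rewrite mulr1 -K1//; congr (K (_, _)); lra.
- move=> s t Is bt; case: ifPn => s2; [rewrite Hb//|rewrite Kb//].
  + by move: Is s2 => /=; lra.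
  + by move: Is s2 => /=; lra.
Qed.

Definition concat_fun (f g : 'rV[R]_m.+1 -> X) t : X :=
  if t ord0 ord0 <= 2^-1 then f (set_first t (2 * t ord0 ord0))
  else g (set_first t (2 * t ord0 ord0 - 1)).

Lemma concat_base (f g : loop) t : cube_boundary t -> concat_fun f g t = x0.
Proof.
move=> bt; have It := cubeI bt.1; rewrite /concat_fun.
have [t0|t0] := eqVneq (t ord0 ord0) 0.
  rewrite t0 invr_ge0 ler0n mulr0 loop_base//.
  by apply: boundary_set_first; [exact: bt.1|left].
have [t1|t1] := eqVneq (t ord0 ord0) 1.
  rewrite t1 ifF; last by lra.
  rewrite loop_base//; apply: boundary_set_first; first exact: bt.1.
  by right; lra.
by case: ifPn => t2; rewrite loop_base//; apply: boundary_set_first_neq => //;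
  try exact/eqP; lra.
Qed.

Lemma continuous_first_aff {S : topologicalType} (u : S -> 'rV[R]_m.+1) (a b : R) :
  continuous u -> continuous (fun s => set_first (u s) (a * u s ord0 ord0 - b)).
Proof.
move=> cu; apply: continuous_set_first => // s.
apply: cvgB; last exact: cvg_cst.
apply: cvgM; first exact: cvg_cst.
exact: continuous_comp_first.
Qed.

Lemma concat_cont (f g : loop) : {within cube, continuous (concat_fun f g)}.
Proof.
have cid : continuous (fun t : 'rV[R]_m.+1 => t) by move=> ?; exact: cvg_id.
apply: (@within_continuous_glue _ _ _ _ (fun t => t ord0 ord0)
  (f \o (fun t => set_first t (2 * t ord0 ord0)))
  (g \o (fun t => set_first t (2 * t ord0 ord0 - 1)))).
- exact: closed_cube.
- exact: continuous_first.
- move=> t It /= ->; rewrite mulfV// subrr !loop_base//.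
    by apply: boundary_set_first => //; left.
  by apply: boundary_set_first => //; right.
- apply: (@within_continuous_compr _ _ _ cube _ f); last exact: loop_cont.
    under [X in continuous X]eq_fun do rewrite -[2 * _]subr0.
    exact: continuous_first_aff.
  move=> t /= [It t2]; apply: cube_set_first => //.
  by have := cubeI It; lra.
- apply: (@within_continuous_compr _ _ _ cube _ g); last exact: loop_cont.
    exact: continuous_first_aff.
  move=> t /= [It t2]; apply: cube_set_first => //.
  by have := cubeI It; lra.
Qed.

Definition concat (f g : loop) : loop :=
  Loop (@concat_cont f g) (@concat_base f g).

Lemma cst_cont : {within cube, continuous (fun _ : 'rV[R]_m.+1 => x0)}.
Proof. by apply: continuous_subspaceT; exact: cst_continuous. Qed.

Definition cst_loop : loop := Loop cst_cont (fun t _ => erefl x0).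

Definition reverse_fun (f : 'rV[R]_m.+1 -> X) t : X :=
  f (set_first t (1 - t ord0 ord0)).

Lemma reverse_cont (f : loop) : {within cube, continuous (reverse_fun f)}.
Proof.
apply: (@within_continuous_compr _ _ _ cube _ f); last exact: loop_cont.
  apply: continuous_set_first => t; first exact: cvg_id.
  by apply: continuousB; [exact: cst_continuous|exact: continuous_first].
move=> t It; apply: cube_set_first => //.
by have := cubeI It; lra.
Qed.

Lemma reverse_base (f : loop) t : cube_boundary t -> reverse_fun f t = x0.
Proof.
move=> bt; have It := cubeI bt.1; rewrite /reverse_fun loop_base//.
have [t0|t0] := eqVneq (t ord0 ord0) 0.
  by apply: boundary_set_first; [exact: bt.1|right; lra].
have [t1|t1] := eqVneq (t ord0 ord0) 1.
  by apply: boundary_set_first; [exact: bt.1|left; lra].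
by apply: boundary_set_first_neq => //; try exact/eqP; lra.
Qed.

Definition reverse (f : loop) : loop :=
  Loop (@reverse_cont f) (@reverse_base f).

Lemma homotopic_concat f f' g g' :
  homotopic f f' -> homotopic g g' -> homotopic (concat f g) (concat f' g').
Proof.
move=> [H [cH H0 H1 Hb]] [K [cK K0 K1 Kb]].
pose l (p : R * 'rV[R]_m.+1) := set_first p.2 (2 * p.2 ord0 ord0).
pose r (p : R * 'rV[R]_m.+1) := set_first p.2 (2 * p.2 ord0 ord0 - 1).
have cl : continuous l.
  rewrite /l; under [X in continuous X]eq_fun do rewrite -[2 * _]subr0.
  by apply: continuous_first_aff => ?; exact: cvg_snd.
have cr : continuous r.
  by apply: continuous_first_aff => ?; exact: cvg_snd.
have lI s t : cube t -> t ord0 ord0 <= 2^-1 -> cube (l (s, t)).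
  move=> It t2; apply: cube_set_first => //=.
  by have := cubeI It; lra.
have rI s t : cube t -> 2^-1 <= t ord0 ord0 -> cube (r (s, t)).
  move=> It t2; apply: cube_set_first => //=.
  by have := cubeI It; lra.
exists (fun p : R * 'rV[R]_m.+1 => if p.2 ord0 ord0 <= 2^-1 then (H \o (fun p => (p.1, l p))) p
            else (K \o (fun p => (p.1, r p))) p); split => /=.
- apply: (@within_continuous_glue _ _ _ _ (fun p : R * 'rV[R]_m.+1 => p.2 ord0 ord0)).
  + exact: closed_Icube.
  + by apply: continuous_comp_first => ?; exact: cvg_snd.
  + move=> [s t] /= [Is It] t2; rewrite /l /r /= t2 mulfV// subrr.
    rewrite Hb ?Kb//; last by apply: boundary_set_first => //; right.
    by apply: boundary_set_first => //; left.
  + apply: within_continuous_compr cH.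
      by apply: continuous_pair => // p; exact: cvg_fst.
    by move=> [s t] /= [[Is It]] s2; split => //=; exact: lI.
  + apply: within_continuous_compr cK.
      by apply: continuous_pair => // p; exact: cvg_fst.
    by move=> [s t] /= [[Is It]] s2; split => //=; exact: rI.
- move=> t It; rewrite /concat_fun; case: ifPn => t2.
    by rewrite H0//; exact: lI.
  by rewrite K0//; apply: rI => //; lra.
- move=> t It; rewrite /concat_fun; case: ifPn => t2.
    by rewrite H1//; exact: lI.
  by rewrite K1//; apply: rI => //; lra.
- move=> s t Is bt; have It := cubeI bt.1; rewrite /l /r /=.
  have [t0|t0] := eqVneq (t ord0 ord0) 0.
    rewrite t0 invr_ge0 ler0n mulr0 Hb//.
    by apply: boundary_set_first; [exact: bt.1|left].
  have [t1|t1] := eqVneq (t ord0 ord0) 1.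
    rewrite t1 ifF; last by lra.
    rewrite Kb//; apply: boundary_set_first; first exact: bt.1.
    by right; lra.
  by case: ifPn => t2; rewrite ?Hb ?Kb//; apply: boundary_set_first_neq => //;
    try exact/eqP; lra.
Qed.

Lemma homotopic_reparam (f g h : loop) (phi psi : R -> R) :
  continuous phi -> continuous psi ->
  (forall x, I x -> I (phi x)) -> (forall x, I x -> I (psi x)) ->
  phi 0 = 0 \/ phi 0 = 1 -> phi 1 = 0 \/ phi 1 = 1 ->
  psi 0 = phi 0 -> psi 1 = phi 1 ->
  (forall t, cube t -> g t = f (set_first t (phi (t ord0 ord0)))) ->
  (forall t, cube t -> h t = f (set_first t (psi (t ord0 ord0)))) ->
  homotopic g h.
Proof.
move=> cphi cpsi Iphi Ipsi phi0 phi1 psi0 psi1 gE hE.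
pose c (p : R * 'rV[R]_m.+1) : R :=
  (1 - p.1) * phi (p.2 ord0 ord0) + p.1 * psi (p.2 ord0 ord0).
have cI (p : R * 'rV[R]_m.+1) : I p.1 -> I (p.2 ord0 ord0) -> I (c p).
  move=> Ip1 Ip2; have := Iphi _ Ip2; have := Ipsi _ Ip2.
  by move: Ip1 => /= ? ? ?; rewrite /c; nra.
have cfirst : continuous (fun p : R * 'rV[R]_m.+1 => p.2 ord0 ord0).
  by apply: continuous_comp_first => ?; exact: cvg_snd.
exists (f \o (fun p : R * 'rV[R]_m.+1 => set_first p.2 (c p))); split => /=.
- apply: (@within_continuous_compr _ _ _ cube _ f); last exact: loop_cont.
    apply: continuous_set_first => p; first exact: cvg_snd.
    apply: cvgD; apply: cvgM.
    + by apply: cvgB; [exact: cvg_cst|exact: cvg_fst].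
    + by apply: (@continuous_comp _ _ _ _ phi); [exact: cfirst|exact: cphi].
    + exact: cvg_fst.
    + by apply: (@continuous_comp _ _ _ _ psi); [exact: cfirst|exact: cpsi].
  by move=> [s t] /= [Is It]; apply: cube_set_first => //; apply: cI => //=.
- by move=> t It; rewrite /c /= subr0 mul1r mul0r addr0 gE.
- by move=> t It; rewrite /c /= subrr mul1r mul0r add0r hE.
- move=> s t Is bt; have It := cubeI bt.1; rewrite loop_base//.
  have [t0|t0] := eqVneq (t ord0 ord0) 0.
    apply: boundary_set_first; first exact: bt.1.
    rewrite /c /= t0 psi0 -mulrDl subrK mul1r; exact: phi0.
  have [t1|t1] := eqVneq (t ord0 ord0) 1.
    apply: boundary_set_first; first exact: bt.1.
    rewrite /c /= t1 psi1 -mulrDl subrK mul1r; exact: phi1.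
  by apply: boundary_set_first_neq => //; try exact/eqP; apply: cI.
Qed.

Lemma continuous_aff (a b : R) : continuous (fun x => a * x + b).
Proof.
move=> x; apply: cvgD; last exact: cvg_cst.
by apply: cvgM; [exact: cvg_cst|exact: cvg_id].
Qed.

Lemma continuous_minr (f g : R -> R) : continuous f -> continuous g ->
  continuous (fun x => Num.min (f x) (g x)).
Proof. by move=> cf cg x; apply: continuous_min; [exact: cf|exact: cg]. Qed.

Lemma continuous_maxr (f g : R -> R) : continuous f -> continuous g ->
  continuous (fun x => Num.max (f x) (g x)).
Proof. by move=> cf cg x; apply: continuous_max; [exact: cf|exact: cg]. Qed.

Local Ltac minmax := rewrite /Num.min /Num.max;
  repeat match goal with |- context [if ?b then _ else _] =>
    lazymatch b with
    | context [if _ then _ else _] => fail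
    | _ => case: (boolP b) => ? /=
    end
  end.

Lemma homotopic_concatA f g h :
  homotopic (concat f (concat g h)) (concat (concat f g) h).
Proof.
pose phi (x : R) := Num.min (Num.min (2 * x + 0) (1 * x + 4^-1)) (2^-1 * x + 2^-1).
apply: homotopic_sym; apply: (@homotopic_reparam (concat f (concat g h)) _ _ phi id).
- by apply: continuous_minr; [apply: continuous_minr|]; exact: continuous_aff.
- by move=> ?; exact: cvg_id.
- by move=> x /=; rewrite /phi; minmax; lra.
- by [].
- by left; rewrite /phi; minmax; lra.
- by right; rewrite /phi; minmax; lra.
- by rewrite /phi; minmax; lra.
- by rewrite /phi; minmax; lra.
- move=> t It; have := cubeI It.
  rewrite /= /concat_fun !set_first0 !set_first_twice.
  move: (t ord0 ord0) => x Ix; rewrite /phi.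
  by minmax; try (exfalso; lra); congr (_ (set_first t _)); lra.
- by move=> t It; rewrite set_first_id.
Qed.

Lemma homotopic_cst_concat f : homotopic (concat cst_loop f) f.
Proof.
pose phi (x : R) := Num.max 0 (2 * x + -1).
apply: (@homotopic_reparam f _ _ phi id).
- apply: continuous_maxr; last exact: continuous_aff.
  by move=> ?; exact: cvg_cst.
- by move=> ?; exact: cvg_id.
- by move=> x /=; rewrite /phi; minmax; lra.
- by [].
- by left; rewrite /phi; minmax; lra.
- by right; rewrite /phi; minmax; lra.
- by rewrite /phi; minmax; lra.
- by rewrite /phi; minmax; lra.
- move=> t It; rewrite /= /concat_fun; case: ifPn => t2.
    rewrite loop_base//; apply: boundary_set_first => //; left.
    by rewrite /phi; minmax; lra.
  by congr (f (set_first _ _)); rewrite /phi; minmax; lra.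
- by move=> t It; rewrite set_first_id.
Qed.

Lemma homotopic_concat_cst f : homotopic (concat f cst_loop) f.
Proof.
pose phi (x : R) := Num.min (2 * x + 0) 1.
apply: (@homotopic_reparam f _ _ phi id).
- apply: continuous_minr; first exact: continuous_aff.
  by move=> ?; exact: cvg_cst.
- by move=> ?; exact: cvg_id.
- by move=> x /=; rewrite /phi; minmax; lra.
- by [].
- by left; rewrite /phi; minmax; lra.
- by right; rewrite /phi; minmax; lra.
- by rewrite /phi; minmax; lra.
- by rewrite /phi; minmax; lra.
- move=> t It; rewrite /= /concat_fun; case: ifPn => t2; last first.
    rewrite loop_base//; apply: boundary_set_first => //; right.
    by rewrite /phi; minmax; lra.
  by congr (f (set_first _ _)); rewrite /phi; minmax; lra.
- by move=> t It; rewrite set_first_id.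
Qed.

Lemma homotopic_reverse_concat f : homotopic (concat (reverse f) f) cst_loop.
Proof.
pose phi (x : R) := Num.max (-2 * x + 1) (2 * x + -1).
apply: (@homotopic_reparam f _ _ phi (fun=> 1)).
- by apply: continuous_maxr; exact: continuous_aff.
- by move=> ?; exact: cvg_cst.
- by move=> x /=; rewrite /phi; minmax; lra.
- by move=> x /= _; rewrite ler01 lexx.
- by right; rewrite /phi; minmax; lra.
- by right; rewrite /phi; minmax; lra.
- by rewrite /phi; minmax; lra.
- by rewrite /phi; minmax; lra.
- move=> t It; rewrite /= /concat_fun /reverse_fun set_first0 set_first_twice.
  by case: ifPn => t2; congr (f (set_first _ _)); rewrite /phi; minmax; lra.
- move=> t It /=; rewrite loop_base//.
  by apply: boundary_set_first => //; right.
Qed.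

Lemma homotopic_concat_reverse f : homotopic (concat f (reverse f)) cst_loop.
Proof.
pose phi (x : R) := Num.min (2 * x + 0) (-2 * x + 2).
apply: (@homotopic_reparam f _ _ phi (fun=> 0)).
- by apply: continuous_minr; exact: continuous_aff.
- by move=> ?; exact: cvg_cst.
- by move=> x /=; rewrite /phi; minmax; lra.
- by move=> x /= _; rewrite ler01 lexx.
- by left; rewrite /phi; minmax; lra.
- by left; rewrite /phi; minmax; lra.
- by rewrite /phi; minmax; lra.
- by rewrite /phi; minmax; lra.
- move=> t It; rewrite /= /concat_fun /reverse_fun set_first0 set_first_twice.
  by case: ifPn => t2; congr (f (set_first _ _)); rewrite /phi; minmax; lra.
- move=> t It /=; rewrite loop_base//.
  by apply: boundary_set_first => //; left.
Qed.

Lemma homotopic_reverse f g :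
  homotopic f g -> homotopic (reverse f) (reverse g).
Proof.
move=> [H [cH H0 H1 Hb]].
pose u (p : R * 'rV[R]_m.+1) := set_first p.2 (1 - p.2 ord0 ord0).
have uI s t : cube t -> cube (u (s, t)).
  move=> It; apply: cube_set_first => //=.
  by have := cubeI It; lra.
exists (H \o (fun p => (p.1, u p))); split => /=.
- apply: within_continuous_compr cH.
    apply: continuous_pair => [p|]; first exact: cvg_fst.
    apply: continuous_set_first => q; first exact: cvg_snd.
    apply: cvgB; first exact: cvg_cst.
    by apply: continuous_comp_first => ?; exact: cvg_snd.
  by move=> [s t] /= [Is It]; split => //=; exact: uI.
- by move=> t It; rewrite H0//; exact: uI.
- by move=> t It; rewrite H1//; exact: uI.
- move=> s t Is bt; have It := cubeI bt.1; rewrite /u /= Hb//.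
  have [t0|t0] := eqVneq (t ord0 ord0) 0.
    by apply: boundary_set_first; [exact: bt.1|right; lra].
  have [t1|t1] := eqVneq (t ord0 ord0) 1.
    by apply: boundary_set_first; [exact: bt.1|left; lra].
  by apply: boundary_set_first_neq => //; try exact/eqP; lra.
Qed.

Definition homotopicb (f g : loop) : bool := `[< homotopic f g >].

Lemma homotopicb_refl : reflexive homotopicb.
Proof. by move=> f; apply/asboolP; exact: homotopic_refl. Qed.

Lemma homotopicb_sym : symmetric homotopicb.
Proof. by move=> f g; apply/asboolP/asboolP => /homotopic_sym. Qed.

Lemma homotopicb_trans : transitive homotopicb.
Proof.
move=> g f h /asboolP fg /asboolP gh; apply/asboolP.
exact: homotopic_trans fg gh.
Qed.

Canonical homotopic_equiv :=
  EquivRel homotopicb homotopicb_refl homotopicb_sym homotopicb_trans.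

Definition loop_class : Type := {eq_quot homotopicb}.
HB.instance Definition _ := Choice.on loop_class.
HB.instance Definition _ := EqQuotient.on loop_class.

Lemma loop_classP (f g : loop) :
  \pi_loop_class f = \pi_loop_class g <-> homotopic f g.
Proof.
split=> [/eqP|fg]; first by rewrite piE => /asboolP.
by apply/eqP; rewrite piE; apply/asboolP.
Qed.

Definition class_mul (a b : loop_class) : loop_class :=
  \pi_loop_class (concat (repr a) (repr b)).
Definition class_one : loop_class := \pi_loop_class cst_loop.
Definition class_inv (a : loop_class) : loop_class :=
  \pi_loop_class (reverse (repr a)).

Lemma homotopic_repr f : homotopic (repr (\pi_loop_class f)) f.
Proof. by apply/loop_classP; rewrite reprK. Qed.

Lemma class_mulE f g :
  class_mul (\pi_loop_class f) (\pi_loop_class g) = \pi_loop_class (concat f g).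
Proof. by apply/loop_classP; apply: homotopic_concat; exact: homotopic_repr. Qed.

Lemma class_invE f :
  class_inv (\pi_loop_class f) = \pi_loop_class (reverse f).
Proof. by apply/loop_classP; apply: homotopic_reverse; exact: homotopic_repr. Qed.

Lemma class_mulA : associative class_mul.
Proof.
move=> a b c; rewrite -[a]reprK -[b]reprK -[c]reprK.
rewrite (class_mulE (repr b)) (class_mulE (repr a) (repr b)) !class_mulE.
by apply/loop_classP; exact: homotopic_concatA.
Qed.

Lemma class_mul1 : left_id class_one class_mul.
Proof.
move=> a; rewrite -[a]reprK class_mulE.
by apply/loop_classP; exact: homotopic_cst_concat.
Qed.

Lemma class_1mul : right_id class_one class_mul.
Proof.
move=> a; rewrite -[a]reprK class_mulE.
by apply/loop_classP; exact: homotopic_concat_cst.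
Qed.

Lemma class_mulV : left_inverse class_one class_inv class_mul.
Proof.
move=> a; rewrite -[a]reprK class_invE class_mulE.
by apply/loop_classP; exact: homotopic_reverse_concat.
Qed.

Lemma class_Vmul : right_inverse class_one class_inv class_mul.
Proof.
move=> a; rewrite -[a]reprK class_invE class_mulE.
by apply/loop_classP; exact: homotopic_concat_reverse.
Qed.

HB.instance Definition _ := isGroup.Build loop_class
  class_mulA class_mul1 class_1mul class_mulV class_Vmul.

End homotopy_group.

Arguments loop R m {X} x0.
Arguments loop_class R m {X} x0.

(** pi_k(X, x0) for 0 < k; for k = 0 this is pi_1, not pi_0. *)
Definition homotopy_group (R : realType) (k : nat) {X : topologicalType}
  (x0 : X) : groupType := loop_class R k.-1 x0.

Definition isomorphic (G H : groupType) : Prop :=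
  exists f : G -> H, bijective f /\ {morph f : x y / (x * y)%g}.

Definition sphere (R : realType) (n : nat) : set 'rV[R]_n :=
  [set x | \sum_(i < n) x ord0 i ^+ 2 = 1].
Arguments sphere : clear implicits.

Lemma prod_topology_cvgP {I : Type} {T : topologicalType}
    (F : set_system {ptws I -> T}) (f : {ptws I -> T}) :
  Filter F -> (F --> f) <-> (forall i, (fun g => g i) @ F --> f i).
Proof.
move=> FF; split=> [Ff i U fiU|Ff].
  have /(_ i) Fi := (cvg_sup _ _ FF).1 Ff.
  apply: Fi.
  exact: (@initial_continuous (I -> T) T (fun g => g i) f U fiU).
apply/cvg_sup => i U.
have -> := @nbhsE (initial_topology (fun g : I -> T => g i)) f.
case=> B [[C oC <-] Cf] /filterS; apply; apply: Ff.
exact: open_nbhs_nbhs.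
Qed.

(** The tensor power V^{\otimes d} of a finite-dimensional V is realized as the
    space of d-linear forms on the dual of V, with the topology of pointwise
    convergence.  By tensor_expansion and tensor_cvg this is the Euclidean
    topology: a form is determined by its finitely many coordinates, and
    pointwise convergence is convergence of these coordinates. *)
Section tensor.
Context {R : realType} (V : vectType R) (d : nat).

Local Notation dual := 'Hom(V, R^o).

Definition dual_form := {ptws ('I_d -> dual) -> R}.

Definition tensor_power : set dual_form :=
  [set A | forall (phi : 'I_d -> dual) (i : 'I_d) (a : R) (u v : dual),
     A (dfwith phi i (a *: u + v)) =
     a * A (dfwith phi i u) + A (dfwith phi i v)].

Definition symmetric_tensor : set dual_form :=
  tensor_power `&`
  [set A | forall (s : 'S_d) (phi : 'I_d -> dual), A (phi \o s) = A phi].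

(** v^{\otimes d} *)
Definition pure_power (v : V) : dual_form := fun phi => \prod_(j < d) phi j v.

Definition symmetric_rank_one : set dual_form :=
  symmetric_tensor `&`
  [set A | exists (c : R) (v : V),
     [/\ c != 0, v != 0 & A = (fun phi => c * pure_power v phi)]].

Lemma dfwith_prod (phi : 'I_d -> dual) i (u : dual) (w : 'I_d -> V) :
  \prod_(j < d) (dfwith phi i u j (w j) : R) =
  u (w i) * \prod_(j < d | j != i) (phi j (w j) : R).
Proof.
rewrite (bigD1 i)//= dfwithin; congr (_ * _); apply: eq_bigr => j ji.
by rewrite dfwithout// eq_sym.
Qed.

Lemma dfwith_prodP (phi : 'I_d -> dual) i a (u v : dual) (w : 'I_d -> V) :
  \prod_(j < d) (dfwith phi i (a *: u + v) j (w j) : R) =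
  a * \prod_(j < d) (dfwith phi i u j (w j) : R) +
  \prod_(j < d) (dfwith phi i v j (w j) : R).
Proof.
by rewrite !dfwith_prod add_lfunE scale_lfunE mulrDl mulrA.
Qed.

Lemma pure_power_symmetric v : symmetric_tensor (pure_power v).
Proof.
split => [phi i a u w|s phi]; first exact: dfwith_prodP.
rewrite /pure_power (reindex_inj (@perm_inj _ s^-1)) /=.
by apply: eq_bigr => j _; rewrite permKV.
Qed.

Local Notation n := (\dim {:V}%VS).
Local Notation e := (vbasis {:V}%VS).

Definition dual_basis (i : 'I_n) : dual := linfun (coord e i : V -> R^o).

Lemma dual_basisE (u : dual) : u = \sum_(i < n) u (e`_i) *: dual_basis i.
Proof.
apply/lfunP => v; rewrite sum_lfunE {1}(coord_vbasis (memvf v)) linear_sum.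
by apply: eq_bigr => i _; rewrite linearZ /= lfunE /= lfunE /= [LHS]mulrC.
Qed.

Definition tensor_coord (f : {ffun 'I_d -> 'I_n}) (A : dual_form) : R :=
  A (fun j => dual_basis (f j)).

Lemma tensor_sum A (phi : 'I_d -> dual) i (c : 'I_n -> R) (u : 'I_n -> dual) :
  tensor_power A ->
  A (dfwith phi i (\sum_j c j *: u j)) = \sum_j c j * A (dfwith phi i (u j)).
Proof.
move=> TA.
have A0 : A (dfwith phi i 0) = 0.
  have := TA phi i 1 0 0; rewrite scaler0 addr0 mul1r => /eqP.
  by rewrite -subr_eq0 opprD addrA subrr sub0r oppr_eq0 => /eqP.
elim/big_rec2 : _ => // j x w _ IH.
by rewrite TA IH.
Qed.

Lemma tensor_eq0 A : tensor_power A ->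
  (forall f, tensor_coord f A = 0) -> forall phi, A phi = 0.
Proof.
move=> TA A0 phi.
suff H k : forall psi : 'I_d -> dual,
    (forall j : 'I_d, (k <= j)%N -> exists i, psi j = dual_basis i) ->
    A psi = 0.
  by apply: (H d) => j; rewrite leqNgt ltn_ord.
elim: k => [|k IH] psi hpsi.
  have {}hpsi j := cid (hpsi j (leq0n j)).
  rewrite -(A0 [ffun j => sval (hpsi j)]) /tensor_coord; congr (A _).
  by apply/funext => j; rewrite ffunE; case: (hpsi j).
have [kd|kd] := ltnP k d; last first.
  by apply: IH => j; rewrite leqNgt (leq_trans (ltn_ord j) kd).
pose i := Ordinal kd.
have -> : psi = dfwith psi i (\sum_(j < n) psi i (e`_j) *: dual_basis j).
  rewrite -dual_basisE; apply/funext => j.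
  by case: dfwithP.
rewrite tensor_sum// big1// => j _; rewrite IH ?mulr0// => l kl.
have [->|il] := eqVneq l i; first by rewrite dfwithin; exists j.
rewrite dfwithout 1?eq_sym//; apply: hpsi.
by rewrite ltn_neqAle kl andbT; apply: contra_neq il => kl'; exact/val_inj.
Qed.

Lemma tensor_expansion A : tensor_power A -> forall phi,
  A phi = \sum_(f : {ffun 'I_d -> 'I_n})
            tensor_coord f A * \prod_(j < d) phi j (e`_(f j)).
Proof.
move=> TA phi.
pose B : dual_form := fun phi => A phi - \sum_(f : {ffun 'I_d -> 'I_n})
  tensor_coord f A * \prod_(j < d) phi j (e`_(f j)).
have TB : tensor_power B.
  move=> psi i a u v; rewrite /B TA mulrBr addrACA -opprD; congr (_ + _ - _).
  rewrite mulr_sumr -big_split /=; apply: eq_bigr => f _.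
  by rewrite dfwith_prodP mulrDr mulrCA.
apply/eqP; rewrite -subr_eq0; apply/eqP; apply: (tensor_eq0 TB) => f.
apply/eqP; rewrite /tensor_coord /B subr_eq0; apply/eqP.
have bE (i j : 'I_n) : dual_basis i (e`_j) = (i == j)%:R.
  by rewrite lfunE /= coord_free 1?eq_sym// (basis_free (vbasisP _)).
rewrite (bigD1 f)//= !big1 ?addr0 ?mulr1// => [g gf|j _].
  have /existsP[j fgj] : [exists j, f j != g j].
    apply/existsPn => h; move/eqP: gf; apply; apply/ffunP => j.
    by apply/esym/eqP; have := h j; rewrite negbK.
  by rewrite (bigD1 j)//= bE (negbTE fgj) mul0r mulr0.
by rewrite bE eqxx.
Qed.

Lemma tensor_cvg (F : set_system dual_form) (A : dual_form) :
  Filter F -> F tensor_power -> tensor_power A ->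
  (F --> A) <-> (forall f, tensor_coord f @ F --> tensor_coord f A).
Proof.
move=> FF FT TA; split=> [FA f|FA].
  by have /(_ (fun j => dual_basis (f j))) := (prod_topology_cvgP A FF).1 FA.
apply: (prod_topology_cvgP A FF).2 => phi; rewrite (tensor_expansion TA).
apply: (@cvg_trans _ ((fun B => \sum_(f : {ffun 'I_d -> 'I_n})
    tensor_coord f B * \prod_(j < d) phi j (e`_(f j))) @ F)).
  apply: near_eq_cvg; apply: filterS FT => B TB.
  by rewrite (tensor_expansion TB).
apply: cvg_big => [|f _]; first exact: add_continuous.
by apply: cvgM; [exact: FA|exact: cvg_cst].
Qed.

End tensor.

Arguments symmetric_rank_one {R} V d.

(* Main.v *)
(** A symmetric tensor of rank one is c u^{(x)d} with c nonzero and u on the unit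
    sphere, and the pair (c, u) is unique up to the sign change
    ((-1)^d c, -u).  Contracting x (x) x recovers u u^T continuously from
    x = c u^{(x)d}, for either parity of d; so along a compact contractible
    parameter space u lifts continuously, by transporting it in finitely many
    small steps, and c is then a continuous coefficient of constant sign.  Hence
    u |-> c0 u^{(x)d} induces a bijection on homotopy classes of k-loops as soon
    as the boundary of the k-cube is connected, i.e. k >= 2.

    For the vanishing, a loop in the sphere is homotopic to the normalization of
    a Lipschitz map G.  Among the rays through a fine grid there are more than
    the cells of a comparable grid of the k-cube, so if k < n - 1 some ray is not
    met by G; off that point the sphere is contracted by stereographic
    projection. *)
Require Import Defs.
From mathcomp Require Import all_boot all_order all_algebra.
From mathcomp Require Import all_classical all_reals all_analysis.
From mathcomp Require Import ring lra.
Import numFieldNormedType.Exports.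
Import Order.TTheory GRing.Theory Num.Theory.
Set Implicit Arguments.
Unset Strict Implicit.
Unset Printing Implicit Defensive.

(** * Unit sphere and normalization *)

Section euclidean.
Local Open Scope classical_set_scope.
Local Open Scope ring_scope.
Context {R : realType} {n : nat}.
Implicit Types (u v w : 'rV[R]_n) (p q : sphere R n).

Definition dot u v : R := \sum_(i < n) u ord0 i * v ord0 i.

Lemma dotC u v : dot u v = dot v u.
Proof. by apply: eq_bigr => i _; rewrite mulrC. Qed.

Lemma dotDl u v w : dot (u + v) w = dot u w + dot v w.
Proof. by rewrite -big_split; apply: eq_bigr => i _; rewrite mxE mulrDl. Qed.

Lemma dotZl a u v : dot (a *: u) v = a * dot u v.
Proof. by rewrite mulr_sumr; apply: eq_bigr => i _; rewrite mxE mulrA. Qed.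

Lemma dotDr u v w : dot w (u + v) = dot w u + dot w v.
Proof. by rewrite dotC dotDl !(dotC w). Qed.

Lemma dotZr a u v : dot u (a *: v) = a * dot u v.
Proof. by rewrite dotC dotZl dotC. Qed.

Lemma dotNl u v : dot (- u) v = - dot u v.
Proof. by rewrite -scaleN1r dotZl mulN1r. Qed.

Lemma dotNr u v : dot u (- v) = - dot u v.
Proof. by rewrite dotC dotNl dotC. Qed.

Definition dotE := (dotDl, dotDr, dotNl, dotNr, dotZl, dotZr).

Lemma dot_ge0 u : 0 <= dot u u.
Proof. by apply: sumr_ge0 => i _; rewrite -expr2 sqr_ge0. Qed.

Lemma dot_eq0 u : (dot u u == 0) = (u == 0).
Proof.
apply/eqP/eqP => [u0|->]; last by rewrite /dot big1// => i _; rewrite mxE mul0r.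
apply/rowP => i; rewrite mxE; apply/eqP; rewrite -sqrf_eq0 expr2; apply/eqP.
by apply: (psumr_eq0P _ u0) => // j _; rewrite -expr2 sqr_ge0.
Qed.

Lemma sphereE u : sphere R n u <-> dot u u = 1.
Proof.
rewrite /sphere /dot /=; under eq_bigr do rewrite expr2; exact: iff_refl.
Qed.

Lemma dot_sphere p : dot (\val p) (\val p) = 1.
Proof. by apply/sphereE; exact: (set_mem (valP p)). Qed.

Lemma sphere_eq p q : dot (\val p) (\val q) = 1 -> p = q.
Proof.
move=> pq; apply: val_inj; apply/eqP; rewrite -subr_eq0 -dot_eq0.
by rewrite !dotE (dotC (\val q)) pq !dot_sphere; apply/eqP; ring.
Qed.

(** The argument [p] is only the default that makes the function total: it is the value at
    [v = 0]. *)
Definition normalize p v : sphere R n :=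
  insubd p ((Num.sqrt (dot v v))^-1 *: v).

Lemma normalizeE p v : v != 0 ->
  \val (normalize p v) = (Num.sqrt (dot v v))^-1 *: v.
Proof.
move=> v0; rewrite insubdK//; apply/mem_set/sphereE.
have vv : 0 < dot v v by rewrite lt_neqAle eq_sym dot_eq0 v0 dot_ge0.
rewrite !dotE mulrA -expr2 exprVn sqr_sqrtr ?mulVf ?gt_eqF//; exact: ltW.
Qed.

Lemma normalize_id p q : normalize p (\val q) = q.
Proof.
apply: val_inj; rewrite normalizeE -?dot_eq0 dot_sphere ?oner_eq0//.
by rewrite sqrtr1 invr1 scale1r.
Qed.

Section cvg.
Context {T : Type} {F : set_system T} {FF : Filter F}.

Lemma cvg_coord (f : T -> 'rV[R]_n) v i :
  f @ F --> v -> (fun t => f t ord0 i) @ F --> v ord0 i.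
Proof.
move=> fv; exact: (@continuous_cvg _ _ _ F FF f (fun u : 'rV[R]_n => u ord0 i)
  v (@coord_continuous R 1 n ord0 i v) fv).
Qed.

Lemma cvg_row (f : T -> 'rV[R]_n) v :
  (forall i, (fun t => f t ord0 i) @ F --> v ord0 i) -> f @ F --> v.
Proof.
move=> fv A [P vP PA].
have : \forall y \near F, forall i, P ord0 i (f y ord0 i).
  by apply: filter_forall => i; apply: fv; exact: vP.
by apply: filterS => y Py; apply: PA => i j; rewrite (ord1 i); exact: Py.
Qed.

Lemma cvg_sum {I : finType} (f : I -> T -> R) (a : I -> R) :
  (forall i, f i @ F --> a i) ->
  (fun t => \sum_i f i t) @ F --> \sum_i a i.
Proof. by move=> fa; apply: cvg_big => //; exact: add_continuous. Qed.

Lemma cvg_dot (f g : T -> 'rV[R]_n) v w :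
  f @ F --> v -> g @ F --> w -> (fun t => dot (f t) (g t)) @ F --> dot v w.
Proof. by move=> fv gw; apply: cvg_sum => i; apply: cvgM; exact: cvg_coord. Qed.

Lemma cvg_set_type {U : topologicalType} {A : set U} (f : T -> A) (a : A) :
  (fun t => \val (f t)) @ F --> \val a -> f @ F --> a.
Proof.
move=> fa P [_ /= [[B oB <-] Ba BP]].
have /fa : nbhs (\val a) B by exact: open_nbhs_nbhs.
by move=> FB; apply: (@filterS T F FF _ _ _ FB) => t; exact: BP.
Qed.

(** Near a nonzero [v] the default is never taken, so [g] and [p] are arbitrary. [transport] relies
    on this, its default being the moving vector itself. *)
Lemma cvg_normalize (f : T -> 'rV[R]_n) (g : T -> sphere R n) p v :
  f @ F --> v -> v != 0 ->
  (fun t => normalize (g t) (f t)) @ F --> normalize p v.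
Proof.
move=> fv v0; apply: cvg_set_type; rewrite normalizeE//.
have fvv := cvg_dot fv fv.
have ff0 : \forall t \near F, f t != 0.
  have : nbhs (dot v v) [set x | x != 0].
    by apply: open_nbhs_nbhs; split; [exact: open_neq|rewrite /= dot_eq0].
  by move=> /fvv H; apply: (@filterS T F FF _ _ _ H) => t /=; rewrite dot_eq0.
apply: (@cvg_trans _
  ((fun t => (Num.sqrt (dot (f t) (f t)))^-1 *: f t) @ F)).
  by apply: near_eq_cvg; apply: (@filterS T F FF _ _ _ ff0) => t ft;
    rewrite normalizeE.
apply: cvg_row => i; under eq_fun do rewrite mxE; rewrite mxE.
apply: cvgM; last exact: cvg_coord.
apply: cvgV.
  by rewrite sqrtr_eq0 -ltNge lt_neqAle eq_sym dot_eq0 v0 dot_ge0.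
by apply: (cvg_comp _ _ fvv); exact: sqrt_continuous.
Qed.

End cvg.

Lemma continuous_val_set {T : topologicalType} (A : set T) :
  continuous (fun a : A => \val a).
Proof. exact: initial_continuous. Qed.

End euclidean.

(** * Sign of a nonvanishing function along a path *)

Section path_sign.
Local Open Scope classical_set_scope.
Local Open Scope ring_scope.
Context {R : realType} {T : topologicalType}.

Lemma path_sign (D : set T) (f : T -> R) (gamma : R -> T) :
  continuous gamma -> (forall s, 0 <= s <= 1 -> D (gamma s)) ->
  {within D, continuous f} -> (forall t, D t -> f t != 0) ->
  0 < f (gamma 0) -> 0 < f (gamma 1).
Proof.
move=> cg gD cf f0 fg0; rewrite ltNge; apply/negP => fg1.
have [|||s] := @IVT R (f \o gamma) 0 1 0.
- exact: ler01.
- apply: within_continuous_compr cf => // s; rewrite /= in_itv /=; exact: gD.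
- by rewrite /= ge_min fg1 orbT le_max (ltW fg0).
rewrite in_itv /= => /gD /f0 + fs0; by rewrite fs0 eqxx.
Qed.

End path_sign.

(** * Lifting along lines *)

Section line_lifting.
Local Open Scope classical_set_scope.
Local Open Scope ring_scope.
Context {R : realType} {n : nat} {X : topologicalType}.
Variable P : 'I_n -> 'I_n -> X -> R.
Implicit Types (u v : sphere R n) (x y : X).

(** The numbers [P i j x] stand for the entries of the orthogonal projector [u u^T] onto the line of
    [x]; they determine [u] up to sign. *)
Definition lifts x u := forall i j, P i j x = \val u ord0 i * \val u ord0 j.

Hypothesis P_continuous : forall i j, continuous (P i j).
Hypothesis lifts_ex : forall x, exists u, lifts x u.

(** The trace of the product of the two projectors, that is, the squared cosine of the angle between
    the lines. It involves no choice of lifts, hence is continuous. *)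
Definition overlap x y : R := \sum_i \sum_j P i j x * P i j y.

Lemma overlapE x y u v :
  lifts x u -> lifts y v -> overlap x y = dot (\val u) (\val v) ^+ 2.
Proof.
move=> xu yv; rewrite expr2 [in RHS]/dot mulr_suml; apply: eq_bigr => i _.
by rewrite mulr_sumr; apply: eq_bigr => j _; rewrite xu yv mulrACA.
Qed.

Lemma overlap_refl x : overlap x x = 1.
Proof.
by have [u xu] := lifts_ex x; rewrite (overlapE xu xu) dot_sphere expr1n.
Qed.

Lemma lifts_same x u v : lifts x u -> lifts x v -> dot (\val u) (\val v) != 0.
Proof.
by move=> xu xv; rewrite -sqrf_eq0 -(overlapE xu xv) overlap_refl oner_eq0.
Qed.

Lemma lifts_eq x u v :
  lifts x u -> lifts x v -> 0 < dot (\val u) (\val v) -> u = v.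
Proof.
move=> xu xv uv; apply: sphere_eq.
have := overlapE xu xv; rewrite overlap_refl => /esym/eqP.
rewrite sqrf_eq1 => /orP[/eqP//|/eqP uvN].
by move: uv; rewrite uvN ltr0N1.
Qed.

(** The orthogonal projection of [u] to the line of [y], nonzero unless [u] is orthogonal to that
    line. *)
Definition transport_vec u y : 'rV[R]_n :=
  \row_j \sum_i \val u ord0 i * P i j y.

Definition transport u y : sphere R n := normalize u (transport_vec u y).

Lemma transport_vecE u y v :
  lifts y v -> transport_vec u y = dot (\val u) (\val v) *: \val v.
Proof.
move=> yv; apply/rowP => j; rewrite !mxE mulr_suml; apply: eq_bigr => i _.
by rewrite yv mulrA.
Qed.

Lemma sphere_neq0 u : \val u != 0.
Proof. by rewrite -dot_eq0 dot_sphere oner_eq0. Qed.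

Lemma transport_vec_neq0 x y u :
  lifts x u -> overlap x y != 0 -> transport_vec u y != 0.
Proof.
move=> xu; have [v yv] := lifts_ex y.
rewrite (overlapE xu yv) sqrf_eq0 (transport_vecE _ yv) scaler_eq0.
by rewrite (negbTE (sphere_neq0 v)) orbF.
Qed.

Lemma transport_lifts x y u :
  lifts x u -> overlap x y != 0 -> lifts y (transport u y).
Proof.
move=> xu xy i j; rewrite normalizeE; last exact: transport_vec_neq0 xu xy.
have [v yv] := lifts_ex y; rewrite yv (transport_vecE _ yv) !dotE dot_sphere.
rewrite mulr1 !mxE; move: xy; rewrite (overlapE xu yv) sqrf_eq0.
set a := dot _ _ => a0.
rewrite mulrACA -expr2 exprVn sqr_sqrtr -?expr2 ?sqr_ge0//.
by rewrite mulrACA -expr2 mulrA mulVf ?mul1r// sqrf_eq0.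
Qed.

Lemma transport_id x u : lifts x u -> transport u x = u.
Proof.
by move=> xu; rewrite /transport (transport_vecE _ xu) dot_sphere scale1r
  normalize_id.
Qed.

(** The overlap is jointly continuous and equals 1 on the diagonal. *)
Lemma cvg_overlap x0 (e : R) : e < 1 ->
  exists2 B, nbhs x0 B & forall x y, B x -> B y -> e < overlap x y.
Proof.
move=> e1.
have c : {for (x0, x0), continuous (fun z : X * X => overlap z.1 z.2)}.
  apply: cvg_sum => i; apply: cvg_sum => j; apply: cvgM.
    by apply: (@continuous_comp _ _ _ fst (P i j));
      [exact: cvg_fst|exact: P_continuous].
  by apply: (@continuous_comp _ _ _ snd (P i j));
    [exact: cvg_snd|exact: P_continuous].
have /c[[B C] /= [x0B x0C] BC] : nbhs (overlap x0 x0) [set a | e < a].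
  by apply: open_nbhs_nbhs; split; [exact: open_gt|rewrite /= overlap_refl].
exists (B `&` C); first exact: filterI.
by move=> x y [Bx _] [_ Cy]; exact: (BC (x, y)).
Qed.

Context {T : topologicalType} (D : set T) (W : R * T -> X).
Local Notation I := [set s : R | 0 <= s <= 1].
Hypothesis D_compact : compact D.
Hypothesis W_continuous : {within I `*` D, continuous W}.

Lemma compact_I : compact I.
Proof.
rewrite (_ : I = `[0, 1]%classic); first exact: segment_compact.
by apply/seteqP; split => s; rewrite /= in_itv.
Qed.

(** Uniform continuity in time, by compactness of the product of the interval and [D]: over short
    time steps no line becomes orthogonal to its predecessor. *)
Lemma overlap_uniform : exists N : nat, forall s s' t, I s -> I s' -> D t ->
  `|s - s'| <= N.+1%:R^-1 -> overlap (W (s, t)) (W (s', t)) != 0.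
Proof.
have := compact_setX compact_I D_compact.
move=> /compact_near_coveringP/near_covering_withinP cov.
have Fr : Filter (0^'+ : set_system R) by exact: filter_filter.
have /(cov R (0^'+) _ Fr) : forall p, (I `*` D) p ->
    \forall p' \near p & e \near 0^'+, (I `*` D) p' -> forall s', I s' ->
      `|p'.1 - s'| < e -> overlap (W p') (W (s', p'.2)) != 0.
  move=> p Dp; have [B xB hB] := cvg_overlap (W p) (@ltr01 R).
  have /subspace_continuousP/(_ p Dp)/(_ B xB) := W_continuous.
  rewrite /nbhs/= /within/= => -[[U V] /= [pU pV] UV].
  have /nbhs_ballP[e /= e0 eU] := pU.
  (* Half the radius leaves room for [s'] next to [s]: both then lie in the ball of radius [e] about
     [p.1]. *)
  exists ([set q | ball p.1 (e / 2) q.1 /\ V q.2], [set a | a < e / 2]) => /=.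
    split.
      exists (ball p.1 (e / 2), V) => //=; split=> //.
      by apply: nbhsx_ballx; rewrite divr_gt0.
    by apply: nbhs_right_lt; rewrite divr_gt0.
  move=> [[s t] a] /= [[ps Vt] ae] [Is Dt] s' Is' ss'.
  rewrite gt_eqF//; apply: hB.
    apply: (UV (s, t)) => //; split => //; apply: eU.
    by apply: le_ball ps; lra.
  apply: (UV (s', t)) => //; split => //; apply: eU => /=.
  rewrite (splitr e); apply: ball_triangle ps _.
  by rewrite /ball /= (lt_trans ss').
move=> H; have [e [he /= e0]] :=
  @filter_ex R _ (at_right_proper_filter 0) _ (@filterI R _ Fr _ _ H (nbhs_right_gt 0)).
have [N Ne] : exists N : nat, N.+1%:R^-1 < e.
  have [N _ NE] := near_infty_natSinv_lt (PosNum e0).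
  by exists N; exact: (NE N (leqnn N)).
exists N => s s' t Is Is' Dt ss'.
by apply: (he (s, t)) => //; exact: le_lt_trans ss' Ne.
Qed.

Context (b : T) (u0 : sphere R n).
Hypothesis W0 : forall t, D t -> W (0, t) = W (0, b).
Hypothesis Wb : forall s, I s -> W (s, b) = W (0, b).
Hypothesis b_u0 : lifts (W (0, b)) u0.

(** [W] contracts the map to be lifted, [W (1, _)], to a constant. The constant lift [u0] at time 0
    is transported through [N.+1] time steps; at [b] the line does not move, hence neither does the
    lift. *)
Lemma homotopy_lift : exists u : T -> sphere R n,
  [/\ {within D, continuous u}, u b = u0 & forall t, D t -> lifts (W (1, t)) (u t)].
Proof.
have [N HN] := overlap_uniform.
pose time j : R := j%:R / N.+1%:R.
have timeI j : (j <= N.+1)%N -> I (time j).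
  by move=> jN; rewrite /= divr_ge0//= ler_pdivrMr// mul1r ler_nat.
pose G := fix G j t := if j is i.+1 then transport (G i t) (W (time j, t)) else u0.
suff /(_ N.+1 (leqnn _)) [cG Gb Gl] : forall j, (j <= N.+1)%N ->
    [/\ {within D, continuous (G j)}, G j b = u0 &
     forall t, D t -> lifts (W (time j, t)) (G j t)].
  by exists (G N.+1); split=> // t /Gl; rewrite /time divff.
elim=> [_|j IH jN].
  split=> //; first by apply: continuous_subspaceT; exact: cst_continuous.
  by move=> t Dt; rewrite /time mul0r W0.
have [cG Gb Gl] := IH (ltnW jN).
have ov t : D t -> overlap (W (time j, t)) (W (time j.+1, t)) != 0.
  move=> Dt; apply: HN => //; [exact: timeI (ltnW jN)|exact: timeI|].
  rewrite /time -mulrBl -natr1 opprD addNKr normrM normrN1 mul1r.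
  by rewrite ger0_norm.
split.
- have cW : {within D, continuous (fun t => W (time j.+1, t))}.
    apply: (within_continuous_compr _ _ W_continuous).
      by apply: continuous_pair => t; [exact: cvg_cst|exact: cvg_id].
    by move=> t Dt; split => //; exact: timeI.
  rewrite continuous_subspace_in => t /set_mem Dt.
  apply: cvg_normalize; last exact: transport_vec_neq0 (Gl t Dt) (ov t Dt).
  apply: cvg_row => k; rewrite mxE; under eq_fun do rewrite mxE.
  apply: cvg_sum => i; apply: cvgM.
    apply: cvg_coord.
    apply: (@continuous_comp (subspace D) _ _ (G j) (fun a => \val a));
      first exact: cG.
    exact: continuous_val_set.
  apply: (@continuous_comp (subspace D) _ _ (fun t => W (time j.+1, t)));
    first exact: cW.
  exact: P_continuous.
- by rewrite /= Gb transport_id// Wb//; exact: timeI.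
- by move=> t Dt; apply: transport_lifts (Gl t Dt) (ov t Dt).
Qed.

End line_lifting.

(** * Homotopy groups of a space of lines *)

Section induced_map.
Local Open Scope classical_set_scope.
Local Open Scope ring_scope.
Local Open Scope quotient_scope.
Context {R : realType} {m : nat} {X Y : topologicalType} (q : Y -> X) (y0 : Y).
Hypothesis q_continuous : continuous q.
Local Notation cube := (@cube R m).
Local Notation loopX := (loop R m (q y0)).
Local Notation loopY := (loop R m y0).

Lemma within_continuous_post {T : topologicalType} (A : set T) (f : T -> Y) :
  {within A, continuous f} -> {within A, continuous (q \o f)}.
Proof.
move=> cf t; apply: (@continuous_comp (subspace A) _ _ f q); first exact: cf.
exact: q_continuous.
Qed.

Lemma loop_map_cont (f : loopY) : {within cube, continuous (q \o f)}.
Proof. by apply: within_continuous_post; exact: loop_cont. Qed.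

Lemma loop_map_base (f : loopY) t : cube_boundary t -> (q \o f) t = q y0.
Proof. by move=> bt; rewrite /= loop_base. Qed.

Definition loop_map (f : loopY) : loopX :=
  Loop (@loop_map_cont f) (@loop_map_base f).

Lemma homotopic_loop_map (f g : loopY) :
  homotopic f g -> homotopic (loop_map f) (loop_map g).
Proof.
move=> [H [cH H0 H1 Hb]]; exists (q \o H); split => /=.
- exact: within_continuous_post.
- by move=> t /H0 ->.
- by move=> t /H1 ->.
- by move=> s t Is /(Hb _ _ Is) ->.
Qed.

Lemma loop_map_concat (f g : loopY) :
  homotopic (loop_map (concat f g)) (concat (loop_map f) (loop_map g)).
Proof.
by apply: homotopic_eq => t _; rewrite /= /concat_fun /=; case: ifP.
Qed.

(** The isomorphism is the inverse [psi] of the induced map [phi], obtained by choice; it is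
    multiplicative because [phi] is multiplicative and injective. *)
Lemma isomorphic_loop_map :
  (forall g : loopX, exists f, homotopic (loop_map f) g) ->
  (forall f f', homotopic (loop_map f) (loop_map f') -> homotopic f f') ->
  isomorphic (loop_class R m (q y0)) (loop_class R m y0).
Proof.
move=> surj inj.
pose phi (a : loop_class R m y0) : loop_class R m (q y0) :=
  \pi_(loop_class R m (q y0)) (loop_map (repr a)).
have phiE f : phi (\pi_(loop_class R m y0) f)
    = \pi_(loop_class R m (q y0)) (loop_map f).
  by apply/loop_classP; apply: homotopic_loop_map; exact: homotopic_repr.
have phiM : {morph phi : x y / (x * y)%g}.
  move=> a b; change (phi (class_mul a b) = class_mul (phi a) (phi b)).
  rewrite -[a]reprK -[b]reprK class_mulE !phiE class_mulE.
  by apply/loop_classP; exact: loop_map_concat.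
have phi_inj : injective phi.
  move=> a b; rewrite -[a]reprK -[b]reprK !phiE => /loop_classP/inj.
  by move/loop_classP.
have psiP (a : loop_class R m (q y0)) : exists b, phi b = a.
  have [f fa] := surj (repr a); exists (\pi_(loop_class R m y0) f).
  by rewrite phiE -[RHS]reprK; apply/loop_classP.
pose psi a := sval (cid (psiP a)).
have psiK : cancel psi phi by move=> a; exact: (svalP (cid (psiP a))).
have phiK : cancel phi psi by move=> b; apply: phi_inj; rewrite psiK.
exists psi; split; first by exists phi.
by move=> a b; apply: phi_inj; rewrite psiK phiM !psiK.
Qed.

End induced_map.

(** * Connectedness of the cube and of its boundary *)

Section cube_paths.
Local Open Scope classical_set_scope.
Local Open Scope ring_scope.
Context {R : realType} {m : nat}.
Local Notation T := 'rV[R]_m.+1.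
Implicit Types t : T.

Lemma cube0 : cube (0 : T).
Proof. by move=> i; rewrite mxE lexx ler01. Qed.

Lemma cube_boundary0 : cube_boundary (0 : T).
Proof. by split; [exact: cube0|exists ord0; left; rewrite mxE]. Qed.

Lemma cube_scale t (s : R) : cube t -> 0 <= s <= 1 -> cube (s *: t).
Proof. by move=> It Is i; rewrite mxE; have := It i; nra. Qed.

Lemma cube_compact : compact (cube : set T).
Proof. exact: (rV_compact (fun=> @compact_I R)). Qed.

Lemma continuous_scale {S : topologicalType} (a : S -> R) (f : S -> T) :
  continuous a -> continuous f -> continuous (fun x => a x *: f x).
Proof.
move=> ca cf x; apply: cvg_row => i; rewrite mxE; under eq_fun do rewrite mxE.
by apply: cvgM; [exact: ca|apply: cvg_coord; exact: cf].
Qed.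

(** The cube is star-shaped about the origin. *)
Lemma cube_sign (f : T -> R) : {within cube, continuous f} ->
  (forall t, cube t -> f t != 0) -> 0 < f 0 -> forall t, cube t -> 0 < f t.
Proof.
move=> cf f0 f00 t It; rewrite -[t]scale1r.
apply: (@path_sign R T cube f (fun s => s *: t)) => //.
- by apply: (@continuous_scale _ idfun (fun=> t)) => s;
    [exact: cvg_id|exact: cvg_cst].
- by move=> s Is; exact: cube_scale.
- by rewrite scale0r.
Qed.

(* A boundary point on the face t_i = 0 or t_i = 1 is joined to t_i e_i inside
   that face, and t_i e_i is joined to 0 inside the face t_j = 0, for j != i. *)
Lemma boundary_sign (f : T -> R) : (0 < m)%N ->
  {within cube_boundary, continuous f} ->
  (forall t, cube_boundary t -> f t != 0) -> 0 < f 0 ->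
  forall t, cube_boundary t -> 0 < f t.
Proof.
move=> m0 cf f0 f00 t [It [i ti]].
have [j ji] : exists j : 'I_m.+1, j != i.
  have [->|i0] := eqVneq i ord0; last by exists ord0; rewrite eq_sym.
  by exists ord_max; rewrite -val_eqE /= -lt0n.
pose u : T := \row_k (if k == i then t ord0 i else 0).
have Iu : cube u by move=> k; rewrite mxE; case: ifP => // _; rewrite lexx ler01.
have fu : 0 < f u.
  rewrite -[u]scale1r; apply: (@path_sign R T cube_boundary f (fun s => s *: u)) => //.
  - by apply: (@continuous_scale _ idfun (fun=> u)) => s;
      [exact: cvg_id|exact: cvg_cst].
  - move=> s Is; split; first exact: cube_scale.
    by exists j; left; rewrite !mxE (negbTE ji) mulr0.
  - by rewrite scale0r.
have -> : t = u + 1 *: (t - u) by rewrite scale1r addrC subrK.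
apply: (@path_sign R T cube_boundary f (fun s => u + s *: (t - u))) => //.
- move=> s; apply: cvgD; first exact: cvg_cst.
  by apply: (@continuous_scale _ idfun (fun=> t - u)) => x;
    [exact: cvg_id|exact: cvg_cst].
- move=> s Is; split.
    move=> k; rewrite !mxE; case: ifP => [/eqP ->|_].
      by rewrite subrr mulr0 addr0.
    by have := cube_scale It Is k; rewrite mxE subr0 add0r.
  by exists i; rewrite !mxE eqxx subrr mulr0 addr0.
- by rewrite scale0r addr0.
Qed.

End cube_paths.

(** * Loops and homotopies of scaled lines, lifted to the sphere *)

Section line_cover.
Local Open Scope classical_set_scope.
Local Open Scope ring_scope.
Context {R : realType} {n m : nat} {X : topologicalType}.
Variables (P : 'I_n -> 'I_n -> X -> R).
(** An abstract form of [c u^d]: [mk] builds the point and [coef] recovers the scalar once a unit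
    vector on the line is chosen. Only nonzero scalars are meaningful for [mk]. *)
Variables (mk : R * sphere R n -> X) (coef : X * sphere R n -> R).
Hypothesis P_continuous : forall i j, continuous (P i j).
Hypothesis lifts_ex : forall x, exists u, lifts P x u.
Hypothesis mk_continuous :
  forall c u, c != 0 -> {for (c, u), continuous mk}.
Hypothesis coef_continuous : continuous coef.
Hypothesis mk_lifts : forall c u, c != 0 -> lifts P (mk (c, u)) u.
Hypothesis coef_mk : forall c u, c != 0 -> coef (mk (c, u), u) = c.
Hypothesis mk_coef :
  forall x u, lifts P x u -> coef (x, u) != 0 /\ mk (coef (x, u), u) = x.
Hypothesis m_gt0 : (0 < m)%N.
Variables (c0 : R) (p0 : sphere R n).
Hypothesis c0_neq0 : c0 != 0.

Local Notation q := (fun u => mk (c0, u)).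
Local Notation x0 := (mk (c0, p0)).
Local Notation I := [set s : R | 0 <= s <= 1].
Local Notation cube := (@cube R m).

Lemma base_map_continuous : continuous q.
Proof.
move=> u; apply: (@continuous_comp _ _ _ (fun u => (c0, u)) mk).
  by apply: (@continuous_pair _ _ _ (fun=> c0) idfun) => v;
    [exact: cst_continuous|exact: cvg_id].
exact: mk_continuous.
Qed.

Lemma lift_dot_continuous {T : topologicalType} (A B : set T)
    (u v : T -> sphere R n) : B `<=` A ->
  {within A, continuous u} -> {within A, continuous v} ->
  {within B, continuous (fun t => dot (\val (u t)) (\val (v t)))}.
Proof.
move=> BA cu cv; apply: (continuous_subspaceW BA) => t.
by apply: cvg_dot; apply: (@continuous_comp (subspace A) _ _ _ (fun a : sphere R n => \val a));
  [exact: cu|exact: continuous_val_set|exact: cv|exact: continuous_val_set].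
Qed.

(** The loop is lifted through its radial contraction [g (s *: t)]. On the boundary the lift is [p0]
    up to a sign, which is constant there, so the lift is again a loop; what remains is to deform
    the coefficient to [c0]. *)
Lemma loop_map_surj (g : loop R m x0) :
  exists f : loop R m p0, homotopic (loop_map base_map_continuous f) g.
Proof.
have g0 : g 0 = x0 by apply: loop_base; exact: cube_boundary0.
have cW : {within I `*` cube,
    continuous (fun p : R * 'rV[R]_m.+1 => g (p.1 *: p.2))}.
  apply: (@within_continuous_compr _ _ _ cube _ g); last exact: loop_cont.
    by apply: continuous_scale => p; [exact: cvg_fst|exact: cvg_snd].
  by move=> [s t] [/= Is It]; exact: cube_scale.
have [|||u [cu u0 ul]] := @homotopy_lift R n X P P_continuous lifts_ex _
    cube _ cube_compact cW 0 p0.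
- by move=> t _; rewrite /= !scale0r.
- by move=> s _; rewrite /= !scaler0.
- by rewrite /= scaler0 g0; exact: mk_lifts.
have {}ul t : cube t -> lifts P (g t) (u t).
  by move=> /ul; rewrite /= scale1r.
have ub t : cube_boundary t -> u t = p0.
  move=> bt; have utl s : cube_boundary s -> lifts P x0 (u s).
    by move=> bs; rewrite -(loop_base g bs); apply: ul; exact: bs.1.
  have p0l : lifts P x0 p0 by exact: mk_lifts.
  apply: (lifts_eq lifts_ex (utl t bt) p0l).
  apply: (@boundary_sign R m (fun t => dot (\val (u t)) (\val p0))) => //.
  - apply: (lift_dot_continuous (A := cube)) => //; first by move=> s [].
    by apply: continuous_subspaceT; exact: cst_continuous.
  - by move=> s bs; exact: lifts_same (utl s bs) p0l.
  - by rewrite u0 dot_sphere.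
exists (Loop cu ub).
pose c t := coef (g t, u t).
have cc : {within cube, continuous c}.
  move=> t; apply: (@continuous_comp (subspace cube) _ _ (fun t => (g t, u t)) coef).
    by apply: continuous_pair => //; exact: loop_cont.
  exact: coef_continuous.
have cn t : cube t -> c t != 0 by move=> /ul /mk_coef [].
have c00 : c 0 = c0 by rewrite /c g0 u0 coef_mk.
(* Multiplying by [c0] treats both signs of [c0] at once. *)
have cp t : cube t -> 0 < c0 * c t.
  apply: (@cube_sign _ _ (fun t => c0 * c t)).
  - by move=> s; apply: cvgM; [exact: cvg_cst|exact: cc].
  - by move=> s Is; rewrite mulf_neq0// cn.
  - by rewrite c00 -expr2 exprn_even_gt0.
(* The segment from [c0] to [c] avoids 0 because its ends have the same sign. *)
pose h (p : R * 'rV[R]_m.+1) := (1 - p.1) * c0 + p.1 * c p.2.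
have hn p : (I `*` cube) p -> h p != 0.
  move=> [/= Is /cp ct]; apply/eqP => hp.
  have : 0 < c0 * h p.
    rewrite /h mulrDr mulrCA (mulrCA c0).
    have c2 : 0 < c0 * c0 by rewrite -expr2 exprn_even_gt0.
    move: Is => /andP[s0 s1]; have [->|s0'] := eqVneq p.1 0.
      by rewrite subr0 mul1r mul0r addr0.
    apply: ltr_wpDl; first by rewrite mulr_ge0 ?subr_ge0// ltW.
    by rewrite mulr_gt0// lt_neqAle eq_sym s0'.
  by rewrite hp mulr0 ltxx.
exists (fun p => mk (h p, u p.2)); split => /=.
- have cpost (S : topologicalType) (f : 'rV[R]_m.+1 -> S) :
      {within cube, continuous f} ->
      {within I `*` cube, continuous (fun p : R * 'rV[R]_m.+1 => f p.2)}.
    move=> cf; apply: (@within_continuous_compr _ _ _ cube _ f _ _ _ cf).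
      by move=> ?; exact: cvg_snd.
    by move=> ? [].
  have c1 : {within I `*` cube, continuous (fun p : R * 'rV[R]_m.+1 => p.1)}.
    by apply: continuous_subspaceT => ?; exact: cvg_fst.
  have ch : {within I `*` cube, continuous h}.
    move=> p; apply: cvgD; apply: cvgM.
    - by apply: cvgB; [exact: cvg_cst|exact: c1].
    - exact: cvg_cst.
    - exact: c1.
    - exact: (cpost _ _ cc).
  rewrite continuous_subspace_in => p /set_mem Dp.
  apply: (@continuous_comp (subspace (I `*` cube)) _ _ (fun p => (h p, u p.2)) mk).
    have cu2 := cpost _ _ cu.
    have cp2 := continuous_pair ch cu2.
    exact: cp2.
  by apply: mk_continuous; exact: hn.
- by move=> t It; rewrite /h /= subr0 mul1r mul0r addr0.
- move=> t It; rewrite /h /= subrr mul1r mul0r add0r.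
  exact: (mk_coef (ul t It)).2.
- move=> s t Is bt; rewrite /h /= ub// /c ub// (loop_base g bt) coef_mk//.
  by rewrite -mulrDl subrK mul1r.
Qed.

(** The homotopy is lifted as a whole, through its contraction to [(0, 0)]. Continuity of signs then
    identifies the lift on the boundary with [p0] and at the two ends with [f] and [g]. *)
Lemma loop_map_inj (f g : loop R m p0) :
  homotopic (loop_map base_map_continuous f) (loop_map base_map_continuous g) ->
  homotopic f g.
Proof.
move=> [H [cH H0 H1 Hb]].
have Hb0 s : I s -> H (s, 0) = x0.
  by move=> Is; apply: Hb => //; exact: cube_boundary0.
have I0 : I 0 by rewrite /= lexx ler01.
have I1 : I 1 by rewrite /= lexx ler01.
have cW : {within I `*` (I `*` cube), continuous
    (fun p : R * (R * 'rV[R]_m.+1) => H (p.1 * p.2.1, p.1 *: p.2.2))}.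
  apply: (within_continuous_compr _ _ cH).
    have c1 : continuous (fun p : R * (R * 'rV[R]_m.+1) => p.1) by move=> ?;
      exact: cvg_fst.
    have c2 : continuous (fun p : R * (R * 'rV[R]_m.+1) => p.2) by move=> ?;
      exact: cvg_snd.
    apply: continuous_pair.
      move=> p; apply: cvgM; first exact: c1.
      by apply: (@continuous_comp _ _ _ _ fst); [exact: c2|exact: cvg_fst].
    apply: continuous_scale => // p.
    by apply: (@continuous_comp _ _ _ _ snd); [exact: c2|exact: cvg_snd].
  move=> [s [a t]] [/= Is [Ia It]]; split => /=; last exact: cube_scale.
  by nra.
have [|||u [cu u0 ul]] := @homotopy_lift R n X P P_continuous lifts_ex _
    (I `*` cube) _ (compact_setX compact_I cube_compact) cW (0, 0) p0.
- by move=> [a t] _; rewrite /= !mul0r !scale0r.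
- by move=> s _; rewrite /= !mulr0 !scaler0.
- by rewrite /= mul0r scaler0 Hb0//; exact: mk_lifts.
have {}ul s t : I s -> cube t -> lifts P (H (s, t)) (u (s, t)).
  by move=> Is It; have := ul (s, t) (conj Is It); rewrite /= mul1r scale1r.
have p0l : lifts P x0 p0 by exact: mk_lifts.
have cup : {within I `*` cube, continuous (fun=> p0)}.
  by apply: continuous_subspaceT; exact: cst_continuous.
(* The edge over the origin comes first: within each slice, signs are propagated from the origin. *)
have ub0 s : I s -> u (s, 0) = p0.
  have l0 r : I r -> lifts P x0 (u (r, 0)).
    by move=> Ir; rewrite -(Hb0 r Ir); apply: ul => //; exact: cube0.
  move=> Is; apply: (lifts_eq lifts_ex (l0 s Is) p0l).
  have := @path_sign R (R * 'rV[R]_m.+1)%type (I `*` [set 0])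
    (fun p => dot (\val (u p)) (\val p0)) (fun r => (r * s, 0)).
  rewrite /= mul0r mul1r; apply.
  - apply: continuous_pair => r; last exact: cvg_cst.
    by apply: cvgM; [exact: cvg_id|exact: cvg_cst].
  - by move=> r Ir; split => //=; move: Is Ir => /=; nra.
  - apply: (lift_dot_continuous (A := I `*` cube)) => //.
    by move=> [r t] [/= Ir ->]; split => //; exact: cube0.
  - by move=> [r t] [/= Ir ->]; exact: lifts_same (l0 r Ir) p0l.
  - by rewrite u0 dot_sphere.
have cus s : I s -> {within cube, continuous (fun t => u (s, t))}.
  move=> Is; apply: (within_continuous_compr _ _ cu).
    by apply: (@continuous_pair _ _ _ (fun=> s) idfun) => t;
      [exact: cst_continuous|exact: cvg_id].
  by move=> t It.
have ub s t : I s -> cube_boundary t -> u (s, t) = p0.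
  move=> Is bt.
  have l r : cube_boundary r -> lifts P x0 (u (s, r)).
    by move=> br; rewrite -(Hb s r Is br); apply: ul => //; exact: br.1.
  apply: (lifts_eq lifts_ex (l t bt) p0l).
  apply: (@boundary_sign R m (fun t => dot (\val (u (s, t))) (\val p0))) => //.
  - apply: (lift_dot_continuous (A := cube)) => //; [by move=> ? []|exact: cus|].
    by apply: continuous_subspaceT; exact: cst_continuous.
  - by move=> r br; exact: lifts_same (l r br) p0l.
  - by rewrite ub0// dot_sphere.
(* At an end of the homotopy the lift and the loop span the same lines and agree at the origin,
   hence on the whole cube. *)
have ue (f' : loop R m p0) s : I s ->
    (forall t, cube t -> H (s, t) = mk (c0, f' t)) ->
    forall t, cube t -> u (s, t) = f' t.
  move=> Is Hf t It.
  have l1 r : cube r -> lifts P (mk (c0, f' r)) (u (s, r)).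
    by move=> Ir; rewrite -Hf//; exact: ul.
  apply: (lifts_eq lifts_ex (l1 t It) (mk_lifts _ c0_neq0)).
  apply: (@cube_sign R m (fun t => dot (\val (u (s, t))) (\val (f' t)))) => //.
  - by apply: (lift_dot_continuous (A := cube)) => //;
      [exact: cus|exact: loop_cont].
  - by move=> r Ir; exact: lifts_same (l1 r Ir) (mk_lifts _ c0_neq0).
  - by rewrite ub0// (loop_base f') 1?dot_sphere//; exact: cube_boundary0.
by exists u; split => //; exact: ue.
Qed.

Theorem line_cover_isomorphic :
  isomorphic (loop_class R m x0) (loop_class R m p0).
Proof.
exact: (isomorphic_loop_map loop_map_surj loop_map_inj).
Qed.

End line_cover.

(** * Rank-one symmetric tensors *)

Section adapted_basis.
Local Open Scope ring_scope.

(** The general linear group is transitive on nonzero vectors: by Gaussian elimination each one is a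
    nonzero multiple of the first unit row times an invertible matrix. *)
Lemma row_transport (F : fieldType) n (p w : 'rV[F]_n) :
  p != 0 -> w != 0 -> exists2 M : 'M[F]_n, M \in unitmx & p *m M = w.
Proof.
have rowE (v : 'rV[F]_n) : v != 0 -> exists a N,
    [/\ a != 0, N \in unitmx & v = a *: (pid_mx 1 *m N : 'rV[F]_n)].
  move=> v0; exists (col_ebase v 0 0), (row_ebase v).
  have a0 : col_ebase v 0 0 != 0.
    rewrite -unitfE -(det_mx11 (col_ebase v)) -unitmxE; exact: col_ebase_unit.
  split=> //; first exact: row_ebase_unit.
  rewrite -{1}[v]mulmx_ebase rank_rV v0 {1}[col_ebase v]mx11_scalar.
  by rewrite mul_scalar_mx -scalemxAl.
move=> /rowE[a [N [a0 uN ->]]] /rowE[c [K [c0 uK ->]]].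
exists (invmx N *m ((c / a) *: K)).
  rewrite unitmx_mul unitmx_inv uN/= unitmxE detZ unitrM -unitmxE uK andbT.
  by rewrite unitfE expf_neq0// mulf_neq0// invr_eq0.
rewrite mulmxA -scalemxAl -mulmxA mulmxV// mulmx1 -scalemxAr -scalemxAl scalerA.
by rewrite divfK.
Qed.

Definition combination (R : realType) (V : vectType R) n (b : 'I_n -> V)
  (u : 'rV[R]_n) : V := \sum_i u ord0 i *: b i.

(** The basis [b], with dual basis [bs], gives [v] the prescribed coordinates [p]. Any base tensor
    [c v^d] can thus be matched with any base point of the sphere. *)
Lemma adapted_basis (R : realType) (V : vectType R) n (v : V) (p : 'rV[R]_n) :
  \dim {:V}%VS = n -> v != 0 -> p != 0 ->
  exists (b : 'I_n -> V) (bs : 'I_n -> 'Hom(V, R^o)),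
    [/\ forall u i, bs i (combination b u) = u ord0 i,
        forall w, combination b (\row_i bs i w) = w & combination b p = v].
Proof.
move=> dimV v0 p0; subst n.
pose e := vbasis {:V}%VS.
pose toV (c : 'rV[R]_(\dim {:V}%VS)) : V := \sum_j c ord0 j *: e`_j.
pose ofV (w : V) : 'rV[R]_(\dim {:V}%VS) := \row_j coord e j w.
have ofVK w : toV (ofV w) = w.
  rewrite {2}(coord_vbasis (memvf w)); apply: eq_bigr => i _.
  by rewrite mxE.
have toVK c : ofV (toV c) = c.
  apply/rowP => i; rewrite mxE /toV coord_sum_free//.
  exact: (basis_free (vbasisP _)).
have ofv0 : ofV v != 0.
  apply: contra_neq v0 => v0; rewrite -[v]ofVK v0 /toV big1// => i _.
  by rewrite mxE scale0r.
have [M uM pM] := row_transport p0 ofv0.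
pose b i := toV (row i M).
pose bs i : 'Hom(V, R^o) := \sum_j (invmx M) j i *: dual_basis j.
have bE u : combination b u = toV (u *m M).
  rewrite /combination /b /toV.
  under eq_bigr => i _ do rewrite scaler_sumr.
  rewrite exchange_big; apply: eq_bigr => j _ /=.
  rewrite mxE scaler_suml; apply: eq_bigr => i _.
  by rewrite mxE scalerA.
have bsE i w : bs i w = (ofV w *m invmx M) ord0 i.
  rewrite /bs sum_lfunE mxE; apply: eq_bigr => j _.
  by rewrite scale_lfunE lfunE /= mxE mulrC.
exists b, bs; split.
- by move=> u i; rewrite bsE bE toVK mulmxK.
- move=> w; rewrite bE (_ : \row_i _ = ofV w *m invmx M).
    by rewrite mulmxKV// ofVK.
  by apply/rowP => i; rewrite mxE bsE.
- by rewrite bE pM ofVK.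
Qed.

End adapted_basis.

(** * Parametrization of rank-one tensors by scalars and unit vectors *)

Section rank_one_lines.
Local Open Scope classical_set_scope.
Local Open Scope ring_scope.
Context {R : realType} (V : vectType R) (d n : nat).
Local Notation dual := 'Hom(V, R^o).
Variables (b : 'I_n -> V) (bs : 'I_n -> dual).
Hypothesis bsE : forall u i, bs i (combination b u) = u ord0 i.
Hypothesis combE : forall w, combination b (\row_i bs i w) = w.
Local Notation X := (symmetric_rank_one V d).
Implicit Types (u v : sphere R n) (x : X).

Lemma scaled_power_symmetric (c : R) (v : V) :
  symmetric_tensor (fun phi : 'I_d -> dual => c * pure_power v phi).
Proof.
have [tv sv] := pure_power_symmetric d v; split=> [phi i a w w'|s phi].
  by rewrite tv mulrDr mulrCA.
by rewrite sv.
Qed.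

Lemma combination_neq0 u : combination b (\val u) != 0.
Proof.
apply: contra_neq (sphere_neq0 u) => u0; apply/rowP => i.
by rewrite -bsE u0 linear0 mxE.
Qed.

(* The value at c = 0 is junk, making rank_one_point total. *)
Definition scale_or_one (c : R) : R := if c == 0 then 1 else c.

Lemma rank_one_point_subproof (p : R * sphere R n) :
  X (fun phi => scale_or_one p.1 * pure_power (combination b (\val p.2)) phi).
Proof.
split; first exact: scaled_power_symmetric.
exists (scale_or_one p.1), (combination b (\val p.2)); split=> //.
  by rewrite /scale_or_one; case: ifPn => // _; exact: oner_neq0.
exact: combination_neq0.
Qed.

Definition rank_one_point (p : R * sphere R n) : X :=
  @exist _ (fun A => A \in X) _ (mem_set (rank_one_point_subproof p)).

Lemma rank_one_pointE c u phi : c != 0 -> \val (rank_one_point (c, u)) phi =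
  c * \prod_j \sum_i \val u ord0 i * phi j (b i).
Proof.
move=> c0; rewrite /= /scale_or_one (negbTE c0) /pure_power; congr (_ * _).
apply: eq_bigr => j _; rewrite /combination linear_sum; apply: eq_bigr => i _.
by rewrite linearZ.
Qed.

Lemma rank_one_point_eq c c' u v : c != 0 -> c' != 0 ->
  (forall phi : 'I_d -> dual,
    c * pure_power (combination b (\val u)) phi =
    c' * pure_power (combination b (\val v)) phi) ->
  rank_one_point (c, u) = rank_one_point (c', v).
Proof.
move=> c0 c0' H; apply: val_inj; apply/funext => phi /=.
by rewrite /scale_or_one (negbTE c0) (negbTE c0').
Qed.

Lemma cvg_prod_fin {T : Type} {F : set_system T} {FF : Filter F} {I : finType}
    (f : I -> T -> R) (a : I -> R) :
  (forall i, f i @ F --> a i) ->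
  (fun t => \prod_i f i t) @ F --> \prod_i a i.
Proof. by move=> fa; apply: cvg_big => //; exact: mul_continuous. Qed.

Lemma eval_continuous (phi : 'I_d -> dual) :
  continuous (fun x => \val x phi).
Proof.
move=> x.
have FF : Filter (fmap (fun y : X => \val y) (nbhs x)).
  by apply: fmap_filter; exact: nbhs_filter.
exact: (prod_topology_cvgP (\val x) FF).1 (@continuous_val_set _ X x) phi.
Qed.

Lemma coord_sphere_continuous i : continuous (fun u => \val u ord0 i).
Proof.
move=> u; apply: (@continuous_comp _ _ _ (fun u : sphere R n => \val u)
  (fun w : 'rV[R]_n => w ord0 i)); first exact: continuous_val_set.
exact: coord_continuous.
Qed.

Lemma rank_one_point_continuous c u :
  c != 0 -> {for (c, u), continuous rank_one_point}.
Proof.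
have cg phi : continuous (fun p : R * sphere R n =>
    p.1 * \prod_(j < d) \sum_i \val p.2 ord0 i * (phi j : dual) (b i)).
  move=> p; have FF : Filter (nbhs p) by exact: nbhs_filter.
  apply: cvgM; first exact: cvg_fst.
  apply: cvg_prod_fin => j; apply: cvg_sum => i; apply: cvgM; last exact: cvg_cst.
  apply: (@continuous_comp _ _ _ snd (fun u => \val u ord0 i)).
    exact: cvg_snd.
  exact: coord_sphere_continuous.
move=> c0; have FF : Filter (nbhs ((c, u) : R * sphere R n)) by exact: nbhs_filter.
apply: cvg_set_type.
apply: (prod_topology_cvgP (\val (rank_one_point (c, u))) _).2 => phi.
rewrite rank_one_pointE//.
(* Near [(c, u)] the scalar stays nonzero, so [scale_or_one] is the identity there and every
   evaluation is polynomial. *)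
have nz : nbhs (c, u) [set p : R * sphere R n | p.1 != 0].
  exists ([set a | a != 0], setT) => /=; last by move=> ? [].
  split; last exact: filterT.
  by apply: open_nbhs_nbhs; split => //; exact: open_neq.
apply: (@cvg_trans _ (fmap (fun p : R * sphere R n =>
    p.1 * \prod_j \sum_i \val p.2 ord0 i * phi j (b i))
  (nbhs ((c, u) : R * sphere R n)))).
  by apply: (@near_eq_cvg _ _ _ FF); apply: filterS nz => -[c' u'] c0';
    exact/esym/rank_one_pointE.
exact: (cg phi (c, u)).
Qed.

Lemma rank_one_point_surj (p0 : sphere R n) x :
  exists c u, c != 0 /\ x = rank_one_point (c, u).
Proof.
have [_ [c [v [c0 v0 xE]]]] := set_mem (valP x).
pose w := \row_i bs i v; pose r := Num.sqrt (dot w w).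
have w0 : w != 0.
  apply: contra_neq v0 => w0; rewrite -[v]combE -/w w0 /combination big1// => i _.
  by rewrite mxE scale0r.
have r0 : r != 0.
  by rewrite sqrtr_eq0 -ltNge lt_neqAle eq_sym dot_eq0 w0 dot_ge0.
(* The norm [r] moves into the scalar: [c v^d = (c r^d) (v / r)^d]. *)
have cr0 : c * r ^+ d != 0 by rewrite mulf_neq0// expf_neq0.
exists (c * r ^+ d), (normalize p0 w); split => //.
apply: val_inj; rewrite /= /scale_or_one (negbTE cr0) normalizeE// -/r xE.
apply/funext => phi; rewrite /pure_power -mulrA; congr (_ * _).
have -> : r ^+ d = \prod_(j < d) r by rewrite prodr_const card_ord.
rewrite -big_split; apply: eq_bigr => j _ /=.
rewrite -[v in LHS]combE -/w /combination !linear_sum mulr_sumr.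
apply: eq_bigr => i _; rewrite !linearZ [(r^-1 *: w) _ _]mxE /=.
change (w ord0 i * phi j (b i) = r * (r^-1 * w ord0 i * phi j (b i)) :> R).
by rewrite -mulrA mulVKf.
Qed.

Definition tensor_frame (f : {ffun 'I_d -> 'I_n}) (x : X) : R :=
  \val x (fun j => bs (f j)).

(** The full contraction of the tensor with the power [u^d] of the vector. *)
Definition line_coef (p : X * sphere R n) : R :=
  \sum_f tensor_frame f p.1 * \prod_j \val p.2 ord0 (f j).

Lemma bs_sum (u : 'rV[R]_n) i : \sum_k u ord0 k * bs i (b k) = u ord0 i.
Proof.
rewrite -[RHS]bsE /combination linear_sum; apply: eq_bigr => k _.
by rewrite linearZ.
Qed.

(** By distributivity the sum over all [f] is a product of [d] equal sums, each the scalar product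
    of [u] and [v]. *)
Lemma line_coefE c u v : c != 0 ->
  line_coef (rank_one_point (c, u), v) = c * dot (\val u) (\val v) ^+ d.
Proof.
move=> c0; rewrite /line_coef /tensor_frame.
under eq_bigr => f _ do
  [rewrite rank_one_pointE//; under eq_bigr do rewrite bs_sum;
   rewrite -mulrA -big_split].
rewrite -mulr_sumr; congr (_ * _).
rewrite -(bigA_distr_bigA (fun _ i => \val u ord0 i * \val v ord0 i)).
by rewrite prodr_const card_ord.
Qed.

Lemma line_coef_continuous : continuous line_coef.
Proof.
move=> p; have FF : Filter (nbhs p) by exact: nbhs_filter.
apply: cvg_sum => f; apply: cvgM.
  by apply: (@continuous_comp _ _ _ fst); [exact: cvg_fst|exact: eval_continuous].
apply: cvg_prod_fin => j.
apply: (@continuous_comp _ _ _ snd (fun u => \val u ord0 (f j)));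
  first exact: cvg_snd.
exact: coord_sphere_continuous.
Qed.

Variable j0 : 'I_d.

Definition pinned_frame (f : {ffun 'I_d -> 'I_n}) (a : 'I_n) : 'I_d -> dual :=
  fun j => if j == j0 then bs a else bs (f j).

(** The contraction of [x] with itself in all slots but [j0]. Being quadratic in [x], it forgets the
    sign of [u] for either parity of [d]. The index [f] also runs over the slot [j0], where it is
    ignored, so each term is counted [n] times. *)
Definition square_contraction (a a' : 'I_n) (x : X) : R :=
  \sum_f \val x (pinned_frame f a) * \val x (pinned_frame f a').

(* For x = c u^d with u on the sphere this is u_a u_a'. *)
Definition line_projector (a a' : 'I_n) (x : X) : R :=
  square_contraction a a' x / \sum_i square_contraction i i x.

(** After distributing, the slot [j0] contributes [n] copies of [u_a u_a'] and every other slot the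
    squared norm of [u], which is 1. *)
Lemma square_contractionE c u a a' : c != 0 ->
  square_contraction a a' (rank_one_point (c, u)) =
  c ^+ 2 * n%:R * (\val u ord0 a * \val u ord0 a').
Proof.
move=> c0; pose g j i :=
  if j == j0 then \val u ord0 a * \val u ord0 a' else \val u ord0 i ^+ 2.
transitivity (c ^+ 2 * \sum_(f : {ffun 'I_d -> 'I_n}) \prod_j g j (f j)).
  rewrite mulr_sumr; apply: eq_bigr => f _.
  rewrite !rank_one_pointE// mulrACA -expr2 -big_split; congr (_ * _).
  apply: eq_bigr => j _; rewrite /pinned_frame /g /=.
  by case: ifP => _; rewrite !bs_sum.
rewrite -bigA_distr_bigA -mulrA; congr (_ * _).
rewrite (bigD1 j0)//= [X in _ * X]big1 => [|j jj0].
  by rewrite mulr1 /g eqxx sumr_const card_ord mulr_natl.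
rewrite /g (negbTE jj0) -[RHS](dot_sphere u); apply: eq_bigr => i _.
by rewrite expr2.
Qed.

Lemma rank_one_point_lifts c u : c != 0 ->
  lifts line_projector (rank_one_point (c, u)) u.
Proof.
move=> c0 i j; rewrite /line_projector square_contractionE//.
under eq_bigr do rewrite square_contractionE//.
rewrite -mulr_sumr -/(dot (\val u) (\val u)) dot_sphere mulr1 mulrAC mulfV ?mul1r//.
rewrite mulf_neq0 ?expf_neq0// pnatr_eq0 -lt0n.
exact: leq_ltn_trans (ltn_ord i).
Qed.

Variable p0 : sphere R n.

(** The trace is [c^2 n], and [n] is nonzero because the sphere contains [p0]. *)
Lemma square_contraction_tr_neq0 x : \sum_i square_contraction i i x != 0.
Proof.
have [c [u [c0 ->]]] := rank_one_point_surj p0 x.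
under eq_bigr do rewrite square_contractionE//.
rewrite -mulr_sumr -/(dot (\val u) (\val u)) dot_sphere mulr1.
rewrite mulf_neq0 ?expf_neq0// pnatr_eq0.
apply: contra_eq_neq (dot_sphere p0) => n0; rewrite /dot big1 => [|i _].
  by rewrite eq_sym oner_neq0.
by have := ltn_ord i; rewrite [X in (_ < X)%N]n0.
Qed.

Lemma line_projector_continuous i j : continuous (line_projector i j).
Proof.
have cs a a' : continuous (square_contraction a a').
  move=> x; have FF : Filter (nbhs x) by exact: nbhs_filter.
  by apply: cvg_sum => f; apply: cvgM; exact: eval_continuous.
move=> x; have FF : Filter (nbhs x) by exact: nbhs_filter.
apply: cvgM; first exact: cs.
apply: cvgV; last by apply: cvg_sum => k; exact: cs.
exact: square_contraction_tr_neq0.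
Qed.

Lemma rank_one_lifts_ex x : exists u, lifts line_projector x u.
Proof.
have [c [u [c0 ->]]] := rank_one_point_surj p0 x.
by exists u; exact: rank_one_point_lifts.
Qed.

(** If [x = c v^d], a lift [u] satisfies [v = e u] with [e = 1] or [e = -1], and
    [c v^d = (c e^d) u^d], where [c e^d] is the value of [line_coef]. *)
Lemma rank_one_point_coef x u : lifts line_projector x u ->
  line_coef (x, u) != 0 /\ rank_one_point (line_coef (x, u), u) = x.
Proof.
have [c [v [c0 ->]]] := rank_one_point_surj p0 x => xu.
have xv := rank_one_point_lifts v c0.
have := overlapE xu xv; rewrite (overlap_refl rank_one_lifts_ex) => /esym e1.
rewrite line_coefE//; set e := dot (\val v) (\val u).
have {}e1 : e ^+ 2 = 1 by rewrite /e dotC.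
have e0 : e != 0 by rewrite -sqrf_eq0 e1 oner_neq0.
have ce0 : c * e ^+ d != 0 by rewrite mulf_neq0// expf_neq0.
have uv : \val v = e *: \val u.
  apply/eqP; rewrite -subr_eq0 -dot_eq0 !dotE !dot_sphere (dotC (\val u)) -/e.
  by apply/eqP; move: e1; rewrite expr2; lra.
split=> //; apply: rank_one_point_eq => // phi.
rewrite -mulrA; congr (_ * _); rewrite uv /pure_power.
have -> : e ^+ d = \prod_(j < d) e by rewrite prodr_const card_ord.
rewrite -big_split; apply: eq_bigr => j _ /=.
rewrite /combination !linear_sum mulr_sumr; apply: eq_bigr => i _.
by rewrite !linearZ mxE /= mulrA.
Qed.

Lemma rank_one_point_line_coef c u : c != 0 ->
  line_coef (rank_one_point (c, u), u) = c.
Proof. by move=> c0; rewrite line_coefE// dot_sphere expr1n mulr1. Qed.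

End rank_one_lines.

Lemma rank_one_isomorphic (R : realType) (V : vectType R) (d n k : nat)
    (A0 : symmetric_rank_one V d) (p0 : sphere R n) :
  (0 < d)%N -> \dim {:V}%VS = n -> (2 <= k)%N ->
  isomorphic (homotopy_group R k A0) (homotopy_group R k p0).
Proof.
move=> d0 dimV k2; have [_ [c [v [c0 v0 A0E]]]] := set_mem (valP A0).
have [b [bs [bsE combE p0v]]] := adapted_basis dimV v0 (sphere_neq0 p0).
have -> : A0 = rank_one_point d bsE (c, p0).
  apply: val_inj; rewrite A0E /= /scale_or_one (negbTE c0) p0v//.
(* The [k]-cube has index [m = k.-1], so [0 < m] amounts to [2 <= k]. The pinned slot is slot 0. *)
apply: (@line_cover_isomorphic R n k.-1 _
  (@line_projector R V d n bs (Ordinal d0)) (rank_one_point d bsE)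
  (@line_coef R V d n bs)) => //.
- move=> i j; exact: line_projector_continuous.
- exact: rank_one_lifts_ex.
- exact: rank_one_point_continuous.
- exact: line_coef_continuous.
- exact: rank_one_point_lifts.
- exact: rank_one_point_line_coef.
- by move=> x u; exact: rank_one_point_coef.
- by case: k k2 => [|[]].
Qed.

(** * Low-dimensional loops in the sphere *)

Section lipschitz_approximation.
Local Open Scope classical_set_scope.
Local Open Scope ring_scope.
Context {R : realType} {m : nat}.
Local Notation T := 'rV[R]_m.+1.
Implicit Types x y z : T.

Definition l1 x y : R := \sum_i `|x ord0 i - y ord0 i|.

Lemma l1C x y : l1 x y = l1 y x.
Proof. by apply: eq_bigr => i _; rewrite distrC. Qed.

Lemma l1_refl x : l1 x x = 0.
Proof. by rewrite /l1 big1// => i _; rewrite subrr normr0. Qed.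

Lemma l1_triangle y x z : l1 x z <= l1 x y + l1 y z.
Proof.
by rewrite -big_split; apply: ler_sum => i _; exact: ler_distD.
Qed.

Lemma l1_ball x y (e : R) : l1 x y < e -> ball x e y.
Proof.
move=> xy; split; first by apply: le_lt_trans xy; exact: sumr_ge0.
move=> i j; rewrite (ord1 i); apply: le_lt_trans xy.
by rewrite /l1 (bigD1 j)//= lerDl; exact: sumr_ge0.
Qed.

(** The Heine-Cantor theorem, by the same covering argument as for the overlap. *)
Lemma cube_uniform (f : T -> R) (e : R) : {within cube, continuous f} -> 0 < e ->
  exists2 r, 0 < r &
    forall x y, cube x -> cube y -> l1 x y < r -> `|f x - f y| < e.
Proof.
move=> cf e0.
have /compact_near_coveringP/near_covering_withinP cov := @cube_compact R m.
have Fr : Filter (0^'+ : set_system R) by exact: filter_filter.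
have /(cov R (0^'+) _ Fr) : forall x, cube x ->
    \forall x' \near x & r \near 0^'+, cube x' -> forall y, cube y ->
      l1 x' y < r -> `|f x' - f y| < e.
  move=> x Ix; have /subspace_continuousP/(_ x Ix) := cf.
  move=> /cvgrPdist_lt/(_ (e / 2)); rewrite divr_gt0// => /(_ isT) fx.
  have /nbhs_ballP[r /= r0 rf] :
    nbhs x [set t | cube t -> `|f x - f t| < e / 2] by exact: fx.
  exists (ball x (r / 2), [set a | a < r / 2]) => /=.
    split; first by apply: nbhsx_ballx; rewrite divr_gt0.
    by apply: nbhs_right_lt; rewrite divr_gt0.
  move=> [x' a] /= [xx' ar] Ix' y Iy x'y.
  have fx' : `|f x - f x'| < e / 2.
    by apply: rf => //; apply: le_ball xx'; move: (r0 : 0 < r); lra.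
  have fy : `|f x - f y| < e / 2.
    apply: rf => //; rewrite [r]splitr; apply: ball_triangle xx' _.
    by apply: l1_ball; exact: lt_trans x'y ar.
  rewrite (splitr e) (le_lt_trans (ler_distD (f x) _ _))// ltrD// distrC//.
move=> H; have [r [hr /= r0]] := @filter_ex R _ (at_right_proper_filter 0) _
  (@filterI R _ Fr _ _ H (nbhs_right_gt 0)).
by exists r => // x y Ix Iy xy; exact: hr.
Qed.

Definition lipschitz (L : R) (g : T -> R) :=
  forall x y, cube x -> cube y -> `|g x - g y| <= L * l1 x y.

Lemma lipschitz_continuous (L : R) g :
  lipschitz L g -> {within cube, continuous g}.
Proof.
move=> gL; apply/subspace_continuousP => x Ix.
have c : (fun y => L * l1 x y) @ within cube (nbhs x) --> 0.
  rewrite -[X in _ --> X](mulr0 L) -(l1_refl x).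
  apply: cvgM; first exact: cvg_cst.
  apply: cvg_sum => i; apply: cvg_norm; apply: cvgB; first exact: cvg_cst.
  by apply: cvg_coord; exact: cvg_within.
apply/cvgrPdist_lt => e e0.
have /cvgrPdist_lt/(_ e e0) ce := c.
have : nbhs x [set t | cube t -> `|0 - L * l1 x t| < e] by exact: ce.
suff S : [set t | cube t -> `|0 - L * l1 x t| < e] `<=`
    [set t | cube t -> `|g x - g t| < e] by apply: filterS.
move=> y /= + Iy => /(_ Iy).
rewrite sub0r normrN => Le; apply: le_lt_trans (gL x y Ix Iy) _.
exact: le_lt_trans (ler_norm _) Le.
Qed.

(* Inf-convolution of f with the cone L * l1. *)
Lemma lipschitz_approx (f : T -> R) (e : R) : {within cube, continuous f} ->
  (forall x, cube x -> `|f x| <= 1) -> 0 < e ->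
  exists g L, [/\ 0 <= L, lipschitz L g & forall x, cube x -> `|g x - f x| <= e].
Proof.
move=> cf f1 e0; have [r r0 fr] := cube_uniform cf e0.
(* With this slope a point at distance at least [r] pays a penalty of at least 2, which bounds the
   oscillation of [f]; only closer points can bring the infimum below [f x]. *)
pose L := 2 / r; have L0 : 0 <= L by rewrite divr_ge0// ltW.
pose A x := [set f y + L * l1 x y | y in cube].
have l10 x y : 0 <= l1 x y by exact: sumr_ge0.
have A0 x : A x !=set0 by exists (f 0 + L * l1 x 0), 0; [exact: cube0|].
have Alb x : has_lbound (A x).
  exists (-1) => _ [y Iy <-]; have := f1 y Iy; rewrite ler_norml => /andP[fy _].
  by rewrite (le_trans fy)// lerDl mulr_ge0.
pose g x := inf (A x).
have gle x y : cube y -> g x <= f y + L * l1 x y.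
  by move=> Iy; apply: ge_inf => //; exists y.
have gL x y : g x - g y <= L * l1 x y.
  rewrite lerBlDr -lerBlDl; apply: lb_le_inf => // _ [z Iz <-].
  rewrite lerBlDl (le_trans (gle x z Iz))// addrCA lerD2l -mulrDr.
  by rewrite ler_wpM2l// l1_triangle.
exists g, L; split=> // [x y Ix Iy|x Ix].
  by rewrite ler_norml gL lerNl opprB l1C gL.
rewrite ler_norml; apply/andP; split; last first.
  by rewrite lerBlDl (le_trans (gle x x Ix))// l1_refl mulr0 addr0 lerDl ltW.
rewrite lerBrDl; apply: lb_le_inf => // _ [y Iy <-].
have [xy|xy] := ltP (l1 x y) r.
  have := fr x y Ix Iy xy; rewrite ltr_norml => /andP[_ fxy].
  by have := mulr_ge0 L0 (l10 x y); lra.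
have : 2 <= L * l1 x y by rewrite /L mulrAC ler_pdivlMr// ler_wpM2l.
have := f1 x Ix; have := f1 y Iy; rewrite !ler_norml => /andP[? ?] /andP[? ?].
by lra.
Qed.

(** For [0 <= e] this subtracts from [v] its truncation to the interval from [-e] to [e], a
    contraction that vanishes on this interval. *)
Definition soft_threshold (e v : R) : R :=
  v - Num.max (- e) (Num.min e v).

Lemma soft_threshold_eq0 e v : `|v| <= e -> soft_threshold e v = 0.
Proof.
rewrite ler_norml => /andP[ev ve].
by rewrite /soft_threshold (min_idPr ve) (max_idPr ev) subrr.
Qed.

Lemma soft_threshold_dist e v : 0 <= e -> `|soft_threshold e v - v| <= e.
Proof.
move=> e0; rewrite /soft_threshold addrAC subrr add0r normrN ler_norml.
by case: (leP e v) => ?; case: (leP (- e) e) => ?; case: (leP (- e) v) => ?; lra.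
Qed.

(** Both the threshold and its difference from the identity are nondecreasing. *)
Lemma soft_threshold_contract e v w : 0 <= e ->
  `|soft_threshold e v - soft_threshold e w| <= `|v - w|.
Proof.
move=> e0; wlog vw : v w / w <= v.
  move=> H; have [/H//|/ltW/H] := leP w v.
  by rewrite distrC [X in _ <= X]distrC.
have [sw sv] : soft_threshold e w <= soft_threshold e v /\
    soft_threshold e v - soft_threshold e w <= v - w.
  by rewrite /soft_threshold; split;
    case: (leP e v) => ?; case: (leP e w) => ?; case: (leP (- e) e) => ?;
    case: (leP (- e) v) => ?; case: (leP (- e) w) => ?; lra.
by rewrite !ger0_norm ?subr_ge0.
Qed.

End lipschitz_approximation.

(** * A ray missed by a Lipschitz map, by counting *)

Section missed_direction.
Local Open Scope classical_set_scope.
Local Open Scope ring_scope.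
Context {R : realType} {m n : nat}.
Local Notation T := 'rV[R]_m.+1.
Variables (G : T -> 'rV[R]_n.+1) (L : R).
Hypothesis L_ge0 : 0 <= L.
Hypothesis G_lipschitz : forall i, lipschitz L (fun t => G t ord0 i).
Hypothesis G_lower : forall t, cube t -> 4^-1 <= dot (G t) (G t).

(** Fixing the first coordinate to 1 puts distinct grid points on distinct rays. *)
Definition grid_direction K (j : {ffun 'I_n -> 'I_K}) : 'rV[R]_n.+1 :=
  \row_i (if unlift ord0 i is Some i' then (j i')%:R / K%:R else 1).

Lemma grid_direction0 K (j : {ffun 'I_n -> 'I_K}) :
  grid_direction j ord0 ord0 = 1.
Proof. by rewrite mxE unlift_none. Qed.

Lemma grid_directionS K (j : {ffun 'I_n -> 'I_K}) i :
  grid_direction j ord0 (lift ord0 i) = (j i)%:R / K%:R.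
Proof. by rewrite mxE liftK. Qed.

Lemma grid_direction_bound K (j : {ffun 'I_n -> 'I_K}) i :
  0 <= grid_direction j ord0 i <= 1.
Proof.
rewrite mxE; case: unliftP => [i' _|_]; last by rewrite ler01 lexx.
have jK := ltn_ord (j i').
have K0 : (0 : R) < K%:R by rewrite ltr0n; exact: leq_ltn_trans jK.
by rewrite divr_ge0 ?ler0n//= ler_pdivrMr// mul1r ler_nat ltnW.
Qed.

(** There are [N.+1] values per coordinate, not [N], because the coordinate 1 has floor [N]. *)
Definition cell N (t : T) : {ffun 'I_m.+1 -> 'I_N.+1} :=
  [ffun k => inord (Num.truncn (N%:R * t ord0 k))].

Lemma cell_l1 N s t : (0 < N)%N -> cube s -> cube t -> cell N s = cell N t ->
  l1 s t <= m.+1%:R / N%:R.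
Proof.
move=> N0 Is It st; have N0' : (0 : R) < N%:R by rewrite ltr0n.
apply: (@le_trans _ _ (\sum_(k < m.+1) N%:R^-1)); last first.
  by rewrite sumr_const card_ord mulr_natl.
apply: ler_sum => k _.
have tr (u : T) : cube u -> let a := Num.truncn (N%:R * u ord0 k) in
    (a < N.+1)%N /\ a%:R <= N%:R * u ord0 k < a.+1%:R.
  move=> /(_ k)/andP[u0 u1] a.
  have Nu0 : 0 <= N%:R * u ord0 k by apply: mulr_ge0 => //; exact: ltW.
  have /andP[h1 h2] := truncn_itv Nu0.
  split; last by rewrite h1 h2.
  rewrite ltnS -(ler_nat R); apply: le_trans h1 _.
  by rewrite ler_piMr// ltW.
have [sN /andP[s1 s2]] := tr s Is; have [tN /andP[t1 t2]] := tr t It.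
have : Num.truncn (N%:R * s ord0 k) = Num.truncn (N%:R * t ord0 k).
  by move/ffunP: st => /(_ k); rewrite !ffunE => /(congr1 val) /=;
    rewrite !inordK.
move=> E; rewrite E in s1 s2.
rewrite -[N%:R^-1]mul1r ler_pdivlMr// mulrC -[X in X * _](gtr0_norm N0').
by rewrite -normrM mulrBr ler_norml; apply/andP; split; move: s2 t2;
  rewrite -natr1; lra.
Qed.

(* Points of the cube whose images lie on two different rays of the grid lie in
   different cells, and for a fine grid there are more rays than cells. *)
Lemma missed_direction : (m.+1 < n)%N ->
  exists q, q != 0 /\ forall t (a : R), cube t -> 0 < a -> G t <> a *: q.
Proof.
move=> mn.
have [C0 C0P] : exists C : nat, 4 * n.+1%:R * (L * m.+1%:R) < C%:R.
  by exists (Num.bound (4 * n.+1%:R * (L * m.+1%:R)));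
     apply: archi_boundP; rewrite ?mulr_ge0.
pose C := C0.+1.
have CP : 4 * n.+1%:R * (L * m.+1%:R) < C%:R.
  by apply: lt_trans C0P _; rewrite ltr_nat.
(* [N] is a multiple of [K] so that the grid of the cube refines with that of the rays, with ratio
   [C] absorbing the Lipschitz constant; [K] exceeds [(2 C)^(m+1)] for the final count. *)
pose K := ((2 * C) ^ m.+1).+1; pose N := (C * K)%N.
apply: contrapT => none.
have hit (j : {ffun 'I_n -> 'I_K}) : exists p : T * R,
    [/\ cube p.1, 0 < p.2 & G p.1 = p.2 *: grid_direction j].
  apply: contrapT => nhit; apply: none; exists (grid_direction j); split.
    apply/eqP => /rowP/(_ ord0); rewrite grid_direction0 mxE => /eqP.
    by rewrite oner_eq0.
  by move=> t a It a0 Ga; apply: nhit; exists (t, a).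
have [p pP] := choice hit.
have N0 : (0 < N)%N by [].
(* The image has norm at least 1/2 and the direction has squared norm at most [n.+1]. *)
have mu_lower j : (2 * n.+1%:R)^-1 <= (p j).2.
  have [It a0 GE] := pP j; have := G_lower It; rewrite GE !dotE.
  have : dot (grid_direction j) (grid_direction j) <= n.+1%:R.
    rewrite -[X in _ <= X%:R]card_ord -sumr_const; apply: ler_sum => i _.
    by have := grid_direction_bound j i; nra.
  set a := (p j).2 in a0 *; set D := dot _ _ => Dn aD.
  have n1 : (1 : R) <= n.+1%:R by rewrite ler1n.
  set nn := n.+1%:R in Dn n1 *.
  rewrite -[X in X <= _]mul1r ler_pdivrMr;
    last by rewrite mulr_gt0// (lt_le_trans ltr01).
  have h : 4^-1 <= a * a * nn.
    by apply: le_trans aD _; rewrite mulrA ler_wpM2l// mulr_ge0// ltW.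
  rewrite leNgt; apply/negP => h2.
  have : (a * (2 * nn)) * (a * (2 * nn)) < 1.
    by rewrite -expr2 expr_lt1// ?mulr_ge0// ltW// mulr_gt0// mulr_gt0 ?(lt_le_trans ltr01).
  by nra.
(* In a common cell the images differ by at most [D] in each coordinate. Coordinate 0 compares the
   scale factors, the others then compare [j] and [j'] with an error below 1, so these integers
   agree. *)
have inj : injective (fun j => cell N (p j).1).
  move=> j j' jj'; apply/ffunP => i; apply: val_inj => /=.
  have [It a0 GE] := pP j; have [It' a0' GE'] := pP j'.
  have dl := cell_l1 N0 It It' jj'.
  pose D := L * m.+1%:R / N%:R.
  have dG k : `|(p j).2 * grid_direction j ord0 k -
               (p j').2 * grid_direction j' ord0 k| <= D.
    have := G_lipschitz k It It';
      rewrite GE GE' mxE [X in _ - X]mxE => /le_trans; apply.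
    by rewrite /D -mulrA ler_wpM2l.
  have := dG (lift ord0 i); have := dG ord0.
  rewrite !grid_direction0 !mulr1.
  have := grid_direction_bound j' (lift ord0 i).
  rewrite !grid_directionS; have := mu_lower j.
  move: (p j).2 (p j').2 a0 a0' => a a' a0 a0'.
  set x := (j i)%:R / K%:R; set y := (j' i)%:R / K%:R => al yb d0 d1.
  have axy : a * `|x - y| <= 2 * D.
    rewrite -{1}(ger0_norm (ltW a0)) -normrM.
    have -> : a * (x - y) = (a * x - a' * y) - (a - a') * y by ring.
    apply: le_trans (ler_normB _ _) _; rewrite mulr_natl mulr2n lerD//.
    rewrite normrM (ger0_norm (andP yb).1).
    by apply: le_trans d0; rewrite ler_piMr// (andP yb).2.
  have K0 : (0 : R) < K%:R by rewrite ltr0n.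
  have C0' : (0 : R) < C%:R by rewrite ltr0n.
  have n0 : (0 : R) < 2 * n.+1%:R by rewrite mulr_gt0// ltr0n.
  have xyK : `|x - y| * K%:R < 1.
    have h1 : `|x - y| <= 2 * n.+1%:R * (2 * D).
      rewrite -ler_pdivrMl//; apply: le_trans axy.
      by rewrite ler_wpM2r.
    have h2 : 2 * n.+1%:R * (2 * D) * K%:R * C%:R < C%:R.
      rewrite /D /N natrM (_ : _ * _ * _ * _ = 4 * n.+1%:R * (L * m.+1%:R))//.
      by field; rewrite !gt_eqF.
    apply: (@le_lt_trans _ _ (2 * n.+1%:R * (2 * D) * K%:R)).
      by rewrite ler_wpM2r// ltW.
    by rewrite -(ltr_pM2r C0') mul1r.
  have : `|(j i)%:R - (j' i)%:R : R| < 1.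
    apply: le_lt_trans xyK; rewrite -[X in _ * X](gtr0_norm K0) -normrM.
    by rewrite mulrBl /x /y !divfK ?gt_eqF.
  rewrite ltr_distl => /andP[]; rewrite ltrBlDr !natr1 !ltr_nat !ltnS => h1 h2.
  by apply/eqP; rewrite eqn_leq h2 h1.
(* The cells number [(N+1)^(m+1) <= (2 C K)^(m+1) < K^(m+2) <= K^n], fewer than the rays. *)
have := leq_card _ inj; rewrite !card_ffun !card_ord leqNgt => /negP; apply.
apply: (@leq_ltn_trans ((2 * C * K) ^ m.+1)).
  by rewrite leq_exp2r// -mulnA mul2n -addnn -addn1 leq_add2l.
rewrite expnMn; apply: (@leq_trans (K ^ m.+2)).
  by rewrite [X in (_ < X)%N]expnS ltn_pmul2r ?expn_gt0.
by rewrite leq_pexp2l.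
Qed.

End missed_direction.

(** * Homotopies in the sphere by normalization *)

Section sphere_loops.
Local Open Scope classical_set_scope.
Local Open Scope ring_scope.
Context {R : realType} {m n : nat} (p0 : sphere R n).
Local Notation T := 'rV[R]_m.+1.
Local Notation cube := (@cube R m).
Local Notation I := [set s : R | 0 <= s <= 1].
Implicit Types f g : loop R m p0.

Lemma normalize_scale p q (a : R) : 0 < a ->
  normalize p (a *: \val q) = q :> sphere R n.
Proof.
move=> a0; apply: sphere_eq.
rewrite normalizeE ?scaler_eq0 ?negb_or ?sphere_neq0 ?andbT ?gt_eqF//.
by rewrite !dotE dot_sphere !mulr1 -expr2 sqrtr_sqr gtr0_norm// mulVf// gt_eqF.
Qed.

Lemma normalize_continuous {S : topologicalType} (A : set S)
    (v : S -> 'rV[R]_n) : {within A, continuous v} ->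
  (forall s, A s -> v s != 0) ->
  {within A, continuous (fun s => normalize p0 (v s))}.
Proof.
move=> cv v0; rewrite continuous_subspace_in => s /set_mem As.
by apply: cvg_normalize; [exact: cv|exact: v0].
Qed.

Lemma loop_val_continuous f : {within cube, continuous (fun t => \val (f t))}.
Proof.
move=> t; apply: (@continuous_comp (subspace cube) _ _ f (fun u : sphere R n => \val u)).
  exact: loop_cont.
exact: continuous_val_set.
Qed.

Lemma within_snd {U : topologicalType} (h : T -> U) :
  {within cube, continuous h} ->
  {within I `*` cube, continuous (fun p : R * T => h p.2)}.
Proof.
move=> ch; apply: (@within_continuous_compr _ _ _ cube _ h _ _ _ ch).
  by move=> ?; exact: cvg_snd.
by move=> ? [].
Qed.

Lemma within_fst : {within I `*` cube, continuous (fun p : R * T => p.1)}.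
Proof. by apply: continuous_subspaceT => ?; exact: cvg_fst. Qed.

Lemma segment_continuous (v w : T -> 'rV[R]_n) :
  {within cube, continuous v} -> {within cube, continuous w} ->
  {within I `*` cube, continuous (fun p : R * T =>
    (1 - p.1) *: v p.2 + p.1 *: w p.2)}.
Proof.
move=> cv cw p; apply: cvgD; apply: cvgZ.
- by apply: cvgB; [exact: cvg_cst|exact: within_fst].
- exact: (within_snd cv).
- exact: within_fst.
- exact: (within_snd cw).
Qed.

(** The segment from [f t] to [G t] avoids the origin, since [f t] has norm 1 and [G t] is at
    distance less than 1; the straight-line homotopy can be normalized. *)
Lemma homotopic_near f (G : T -> 'rV[R]_n) :
  {within cube, continuous G} -> (forall t, cube_boundary t -> G t = \val p0) ->
  (forall t, cube t -> dot (G t - \val (f t)) (G t - \val (f t)) < 1) ->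
  exists2 h : loop R m p0, homotopic f h &
    forall t, cube t -> h t = normalize p0 (G t).
Proof.
move=> cG Gb Gf.
pose K (p : R * T) := (1 - p.1) *: \val (f p.2) + p.1 *: G p.2.
have K0 p : (I `*` cube) p -> K p != 0.
  case: p => s t [/= Is It]; apply/eqP => Kst.
  have /(congr1 (fun v => dot v v)) :
      \val (f t) = (- s) *: (G t - \val (f t)).
    apply/eqP; rewrite -subr_eq0 -Kst; apply/eqP/rowP => i; rewrite !mxE /=.
    by ring.
  rewrite dotZl dotZr dot_sphere => /eqP; apply/negP; rewrite gt_eqF//.
  have := Gf t It; have := dot_ge0 (G t - \val (f t)).
  set a := dot _ _ => a0 a1; move: Is => /andP[s0 s1].
  rewrite !mulNr mulrN opprK mulrA; apply: le_lt_trans a1.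
  by rewrite ler_piMl// mulr_ile1.
have hc : {within cube, continuous (fun t => normalize p0 (G t))}.
  apply: normalize_continuous => // t It.
  have /K0 : (I `*` cube) (1, t) by split => //=; rewrite ler01 lexx.
  by rewrite /K /= subrr scale0r add0r scale1r.
have hb t : cube_boundary t -> normalize p0 (G t) = p0.
  by move=> /Gb ->; exact: normalize_id.
exists (Loop hc hb) => //; exists (fun p => normalize p0 (K p)); split.
- apply: normalize_continuous => //.
  exact: (segment_continuous (@loop_val_continuous f) cG).
- by move=> t It; rewrite /K /= subr0 scale0r addr0 scale1r normalize_id.
- by move=> t It; rewrite /K /= subrr scale0r add0r scale1r.
- move=> s t Is bt; rewrite /K /= (Gb t bt) (loop_base f bt) -scalerDl subrK.
  by rewrite scale1r normalize_id.
Qed.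

(* Stereographic projection from q is z = (x - q) / (1 - x.q), with values in
   the hyperplane z.q = -1, and |z|^2 q + 2 z is a positive multiple of x. *)
Lemma missed_point_null f (q : sphere R n) :
  (forall t, cube t -> f t <> q) -> homotopic f (cst_loop p0).
Proof.
move=> fq.
have p0q : p0 <> q.
  rewrite -(loop_base f (@cube_boundary0 R m)); apply: fq; exact: cube0.
pose z (x : sphere R n) := (1 - dot (\val x) (\val q))^-1 *: (\val x - \val q).
have xq0 (x : sphere R n) : x <> q -> 0 < 1 - dot (\val x) (\val q).
  move=> xq; have : 0 < dot (\val x - \val q) (\val x - \val q).
    rewrite lt_neqAle eq_sym dot_eq0 dot_ge0 andbT subr_eq0.
    by apply/eqP => /val_inj.
  rewrite !dotE !dot_sphere (dotC (\val q)); lra.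
have zq x : x <> q -> dot (z x) (\val q) = -1.
  move=> /xq0 xq; rewrite /z !dotE dot_sphere -[X in _ * X]opprB mulrN mulVf//.
  by rewrite gt_eqF.
(* Up to normalization, the inverse of the projection [z]. On the hyperplane its norm is the squared
   norm of [w], which is nonzero there. *)
pose S (w : 'rV[R]_n) := dot w w *: \val q + 2 *: w.
have SS w : dot w (\val q) = -1 -> dot (S w) (S w) = dot w w ^+ 2.
  by move=> wq; rewrite /S !dotE dot_sphere (dotC (\val q)) wq; ring.
have S0 w : dot w (\val q) = -1 -> S w != 0.
  move=> wq; rewrite -dot_eq0 SS// sqrf_eq0 dot_eq0.
  apply: contra_eq_neq wq => ->; rewrite /dot big1 => [|i _].
    by rewrite eq_sym oppr_eq0 oner_neq0.
  by rewrite mxE mul0r.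
have Sz x : x <> q -> normalize p0 (S (z x)) = x.
  move=> xq; have x0 := xq0 x xq.
  have zz : dot (z x) (z x) = 2 / (1 - dot (\val x) (\val q)).
    rewrite /z !dotE !dot_sphere (dotC (\val q)).
    by field; rewrite gt_eqF.
  rewrite /S zz /z scalerA -scalerDr [\val q + _]addrC subrK normalize_scale//.
  by rewrite divr_gt0.
(* The hyperplane is convex, so this segment stays in it, and it is constant where [f] takes the
   value [p0]. *)
pose K (p : R * T) := (1 - p.1) *: z (f p.2) + p.1 *: z p0.
have Kq p : (I `*` cube) p -> dot (K p) (\val q) = -1.
  case: p => s t [/= Is It]; rewrite /K /= dotDl (dotZl (1 - s)) (dotZl s) !zq//; first by ring.
  exact: fq.
have cK : {within I `*` cube, continuous K}.
  apply: (@segment_continuous (fun t => z (f t)) (fun=> z p0)); last first.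
    by apply: continuous_subspaceT; exact: cst_continuous.
  rewrite continuous_subspace_in => t /set_mem It.
  apply: cvgZ.
    apply: cvgV; first by rewrite gt_eqF//; apply: xq0; exact: fq.
    apply: cvgB; first exact: cvg_cst.
    by apply: cvg_dot; [exact: loop_val_continuous|exact: cvg_cst].
  by apply: cvgB; [exact: loop_val_continuous|exact: cvg_cst].
exists (fun p => normalize p0 (S (K p))); split.
- apply: normalize_continuous; last by move=> p /Kq /S0.
  move=> p; apply: cvgD; apply: cvgZ; [|exact: cvg_cst|exact: cvg_cst|exact: cK].
  by apply: cvg_dot; exact: cK.
- by move=> t It; rewrite /K /= subr0 scale0r addr0 scale1r Sz//; exact: fq.
- by move=> t It; rewrite /K /= subrr scale0r add0r scale1r Sz.
- by move=> s t Is bt; rewrite /K /= (loop_base f bt) -scalerDl subrK scale1r Sz.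
Qed.

End sphere_loops.

(** * Vanishing below the dimension of the sphere *)

Section sphere_null.
Local Open Scope classical_set_scope.
Local Open Scope ring_scope.
Context {R : realType} {m n : nat} (p0 : sphere R n.+1).
Local Notation T := 'rV[R]_m.+1.

Lemma sphere_coord_le1 (u : sphere R n.+1) i : `|\val u ord0 i| <= 1.
Proof.
rewrite -(@expr_le1 _ 2)// -normrX ger0_norm ?sqr_ge0// -(dot_sphere u).
by rewrite /dot (bigD1 i)//= expr2 lerDl sumr_ge0// => j _;
  rewrite -expr2 sqr_ge0.
Qed.

(* Lipschitz approximations of the coordinates are pulled towards those of p0
   by soft thresholding, which restores the boundary values. *)
Lemma sphere_lipschitz_approx (f : loop R m p0) :
  exists (G : T -> 'rV[R]_n.+1) (L : R),
    [/\ 0 <= L, forall i, lipschitz L (fun t => G t ord0 i),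
        forall t, cube_boundary t -> G t = \val p0 &
        forall t, cube t -> dot (G t - \val (f t)) (G t - \val (f t)) <= 4^-1].
Proof.
(* Approximation and thresholding each cost at most [e] per coordinate, so the squared error is at
   most [(n+1) (2 e)^2 = 1 / (4 (n+1))]. *)
pose e : R := (4 * n.+1%:R)^-1.
have e0 : 0 < e by rewrite invr_gt0 mulr_gt0// ltr0n.
have fi i : {within cube, continuous (fun t => \val (f t) ord0 i)}.
  by move=> t; apply: cvg_coord; exact: loop_val_continuous.
have app i := lipschitz_approx (fi i) (fun t _ => sphere_coord_le1 (f t) i) e0.
have [g /choice[L gL]] := choice app.
pose c i : R := \val p0 ord0 i.
pose G t : 'rV[R]_n.+1 := \row_i (c i + soft_threshold e (g i t - c i)).
have L0 i : 0 <= L i by have [] := gL i.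
exists G, (\sum_i L i); split.
- exact: sumr_ge0.
- move=> i x y Ix Iy; rewrite !mxE opprD addrACA subrr add0r.
  apply: le_trans (soft_threshold_contract _ _ (ltW e0)) _.
  rewrite opprB addrA subrK; have [_ h _] := gL i.
  apply: le_trans (h x y Ix Iy) _; rewrite ler_wpM2r//; first exact: sumr_ge0.
  by rewrite (bigD1 i)//= lerDl sumr_ge0.
- move=> t bt; apply/rowP => i; rewrite mxE soft_threshold_eq0 ?addr0//.
  by have [_ _ /(_ t bt.1)] := gL i; rewrite (loop_base f bt).
- move=> t It; apply: (@le_trans _ _ (\sum_(i < n.+1) (2 * e) ^+ 2)).
    apply: ler_sum => i _; rewrite !mxE -expr2 -real_normK ?num_real// ler_sqr.
    - have [_ _ /(_ t It) h] := gL i.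
      have -> : c i + soft_threshold e (g i t - c i) - \val (f t) ord0 i =
          (soft_threshold e (g i t - c i) - (g i t - c i)) +
          (g i t - \val (f t) ord0 i) by ring.
      apply: le_trans (ler_normD _ _) _; rewrite mulr_natl mulr2n lerD//.
      exact: soft_threshold_dist (ltW e0).
    - by rewrite nnegrE.
    - by rewrite nnegrE mulr_ge0// ltW.
  rewrite sumr_const card_ord -[X in X <= _]mulr_natl /e.
  have n1 : (1 : R) <= n.+1%:R by rewrite ler1n.
  set N := n.+1%:R in n1 *.
  have N0 : N != 0 by rewrite gt_eqF// (lt_le_trans ltr01).
  have -> : N * (2 * (4 * N)^-1) ^+ 2 = 4^-1 * N^-1 by field.
  rewrite ler_piMr ?invr_ge0// invf_le1// (lt_le_trans ltr01)//.
Qed.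

(** Here [m.+1] is the dimension of the cube and [n] that of the sphere. *)
Lemma sphere_null (f : loop R m p0) : (m.+1 < n)%N -> homotopic f (cst_loop p0).
Proof.
move=> mn; have [G [L [L0 GL Gb Gf]]] := sphere_lipschitz_approx f.
have cG : {within cube, continuous G}.
  by move=> t; apply: cvg_row => i; exact: (lipschitz_continuous (GL i)).
have Gf1 t : cube t -> dot (G t - \val (f t)) (G t - \val (f t)) < 1.
  by move=> /Gf /le_lt_trans; apply; rewrite invf_lt1// ltr1n.
have [h fh hE] := homotopic_near cG Gb Gf1.
(* The triangle inequality in squared form: it follows linearly from the nonnegativity of the
   squared norm of [2 G t - f t]. *)
have Glow t : cube t -> 4^-1 <= dot (G t) (G t).
  move=> It; have := Gf t It.
  have := dot_ge0 (G t + (G t - \val (f t))).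
  have := dot_sphere (f t); rewrite !dotE (dotC (\val (f t))).
  lra.
have [q [q0 Gq]] := missed_direction L0 GL Glow mn.
(* If [G t] and [q] had the same normalization, [G t] would lie on the ray of [q]. *)
apply: homotopic_trans fh (@missed_point_null _ _ _ _ h (normalize p0 q) _).
move=> t It; rewrite hE// => /(congr1 val) Gtq.
have Gt0 : G t != 0.
  by rewrite -dot_eq0 gt_eqF// (lt_le_trans _ (Glow t It))// invr_gt0.
have sqrt_gt0 (v : 'rV[R]_n.+1) : v != 0 -> 0 < Num.sqrt (dot v v).
  by move=> v0; rewrite sqrtr_gt0 lt_neqAle eq_sym dot_eq0 v0 dot_ge0.
have [sG sq] := (sqrt_gt0 _ Gt0, sqrt_gt0 _ q0).
apply: (Gq t (Num.sqrt (dot (G t) (G t)) / Num.sqrt (dot q q))) => //.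
  exact: divr_gt0.
move: Gtq; rewrite !normalizeE// -scalerA => <-.
by rewrite scalerA divff ?scale1r// gt_eqF.
Qed.

End sphere_null.

(** * Transfer of the vanishing to rank-one tensors *)

Lemma sphere_inhabited (R : realType) (n : nat) :
  exists p : sphere R n.+1, True.
Proof.
have h : sphere R n.+1 (delta_mx ord0 ord0).
  apply/sphereE; rewrite /dot (bigD1 ord0)//= big1 => [|i /negbTE i0].
    by rewrite mxE !eqxx mulr1 addr0.
  by rewrite mxE i0 andbF mul0r.
by exists (@exist _ (fun v => v \in sphere R n.+1) _ (mem_set h)).
Qed.

Lemma isomorphic_trivial (G H : groupType) :
  isomorphic G H -> (forall y : H, y = 1%g) -> forall x : G, x = 1%g.
Proof.
move=> [f [bf _]] H1 x; apply: (bij_inj bf).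
by rewrite (H1 (f x)) (H1 (f 1%g)).
Qed.

Theorem theorem7p5 (R : realType) (V : vectType R) (d n k : nat) :
  (3 <= d)%N -> \dim {:V}%VS = n -> (2 <= n)%N -> (2 <= k)%N ->
  (forall (A0 : symmetric_rank_one V d) (p0 : sphere R n),
     isomorphic (homotopy_group R k A0) (homotopy_group R k p0)) /\
  ((4 <= n)%N -> (k <= n - 2)%N ->
     forall (A0 : symmetric_rank_one V d) (a : homotopy_group R k A0),
       a = 1%g).
Proof.
move=> d3 dimV n2 k2.
have d0 : (0 < d)%N by exact: leq_trans d3.
split=> [A0 p0|n4 kn A0 a]; first exact: rank_one_isomorphic.
(* From here on [n] is the dimension of the sphere, and the bound on [k] becomes [k < n]. *)
case: n dimV n2 n4 kn => // n dimV n2 n4 kn.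
have [p0 _] := sphere_inhabited R n.
apply: (isomorphic_trivial (rank_one_isomorphic A0 p0 d0 dimV k2)) => y.
rewrite -[y]reprK; apply/loop_classP/sphere_null.
rewrite prednK; last exact: leq_trans k2.
by case: n n4 kn {dimV n2 p0 y} => [|n] // _;
  rewrite !subSS subn0 ltnS => /leq_trans; apply.
Qed.
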